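(* Let $p$ be a prime and let $\mathcal{F}$ be a saturated fusion system over a discrete $p$-toral group $S$ such that either $Z(\mathcal{F})=1$ or $\mathfrak{foc}(\mathcal{F})=S$. Assume $\mathcal{F}=\mathcal{E}_1\times\cdots\times\mathcal{E}_k$ where each $\mathcal{E}_i$ is an indecomposable fusion subsystem over $T_i\trianglelefteq S$, and set $$\mathrm{Aut}^0(\mathcal{F})=\{\alpha\in\mathrm{Aut}(\mathcal{F})\mid \alpha(T_i)=T_i\text{ for each }1\le i\le k\}.$$ Let $\Gamma\le\Sigma_k$ be the subgroup of all permutations $\sigma$ such that $\mathcal{E}_{\sigma(i)}\cong\mathcal{E}_i$ for each $i$. Then $\mathrm{Aut}^0(\mathcal{F})\cong\prod_{i=1}^k\mathrm{Aut}(\mathcal{E}_i)$ and is normal in $\mathrm{Aut}(\mathcal{F})$, and there is a subgroup $K\le\mathrm{Aut}(\mathcal{F})$ such that $K\cong\Gamma\cong\mathrm{Aut}(\mathcal{F})/\mathrm{Aut}^0(\mathcal{F})$ and $\mathrm{Aut}(\mathcal{F})=\mathrm{Aut}^0(\mathcal{F})\rtimes K$.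
   Context: $\mathbb{Z}/p^\infty$ is the union of the chain $\mathbb{Z}/p\le\mathbb{Z}/p^2\le\cdots$ of finite cyclic $p$-groups. A discrete $p$-toral group is a group $S$ with a normal subgroup $S_0$ such that $S_0$ is isomorphic to a finite product of copies of $\mathbb{Z}/p^\infty$ and $S/S_0$ is a finite $p$-group. For $P,Q\le S$, $\mathrm{Inj}(P,Q)$ is the set of injective homomorphisms $P\to Q$, $\mathrm{Hom}_S(P,Q)$ is the set of homomorphisms $P\to Q$ of the form $x\mapsto c_g(x)=gxg^{-1}$ with $g\in S$, and $\mathrm{Aut}_S(P)=\mathrm{Hom}_S(P,P)\cap\mathrm{Aut}(P)$. A fusion system $\mathcal{F}$ over $S$ is a category whose objects are the subgroups of $S$, with $\mathrm{Hom}_S(P,Q)\subseteq\mathrm{Hom}_{\mathcal F}(P,Q)\subseteq\mathrm{Inj}(P,Q)$ for all $P,Q\le S$, and such that every morphism in $\mathcal F$ factors as an isomorphism in $\mathcal F$ followed by an inclusion. Subgroups $P,P'$ are $\mathcal F$-conjugate if they are isomorphic in $\mathcal F$; elements $x,y$ are $\mathcal F$-conjugate if some $\varphi\in\mathrm{Hom}_{\mathcal F}(\langle x\rangle,\langle y\rangle)$ has $\varphi(x)=y$; the conjugacy classes are $P^{\mathcal F}$ and $x^{\mathcal F}$. $P\le S$ is fully automized if the index of $\mathrm{Aut}_S(P)$ in $\mathrm{Aut}_{\mathcal F}(P)$ is finite and prime to $p$; $P$ is receptive if for each $Q\in P^{\mathcal F}$ and each isomorphism $\varphi\in\mathrm{Iso}_{\mathcal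 F}(Q,P)$, $\varphi$ extends to some $\bar\varphi\in\mathrm{Hom}_{\mathcal F}(N_\varphi,S)$, where $N_\varphi=\{g\in N_S(Q)\mid \varphi c_g\varphi^{-1}\in\mathrm{Aut}_S(P)\}$. $\mathcal F$ is saturated if (i) each $P\le S$ is $\mathcal F$-conjugate to a subgroup that is fully automized and receptive; and (ii) whenever $P_1\le P_2\le\cdots$ are subgroups of $S$ with union $P_\infty$ and $\varphi\in\mathrm{Hom}(P_\infty,S)$ satisfies $\varphi|_{P_n}\in\mathrm{Hom}_{\mathcal F}(P_n,S)$ for all $n$, then $\varphi\in\mathrm{Hom}_{\mathcal F}(P_\infty,S)$. A subgroup $P\le S$ is central in $\mathcal F$ if each $\varphi\in\mathrm{Hom}_{\mathcal F}(Q,R)$ ($Q,R\le S$) extends to some $\bar\varphi\in\mathrm{Hom}_{\mathcal F}(QP,RP)$ with $\bar\varphi|_P=\mathrm{Id}_P$. $Z(\mathcal F)$ is the subgroup generated by all subgroups central in $\mathcal F$, and $\mathfrak{foc}(\mathcal F)=\langle xy^{-1}\mid x,y\in S,\ y\in x^{\mathcal F}\rangle$. A fusion subsystem of $\mathcal F$ is a subcategory $\mathcal E$ whose objects are the subgroups of some $T\le S$ and which is a fusion system over $T$. For fusion systems $\mathcal E$ over $T$ and $\mathcal F$ over $S$, a morphism from $\mathcal E$ to $\mathcal F$ is a homomorphism $f\colon T\to S$ for which there is a (necessarily unique) functor $\hat f\colon\mathcal E\to\mathcal F$ with $\hat f(P)=f(P)$ for all $P\le T$ and $\hat f(\varphi)(f(x))=f(\varphi(x))$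 for all $\varphi\in\mathrm{Hom}_{\mathcal E}(P,Q)$ and $x\in P$. $\mathrm{Mor}(\mathcal E,\mathcal F)$ is the set of morphisms, $\mathrm{Aut}(\mathcal F)$ is the group of invertible elements of $\mathrm{Mor}(\mathcal F,\mathcal F)$, and $\cong$ between fusion systems means existence of an invertible morphism. The direct product of fusion systems $\mathcal F_i$ over $S_i$ ($1\le i\le k$) is the fusion system over $S_1\times\cdots\times S_k$ with $\mathrm{Hom}(P,Q)=\{(\varphi_1,\dots,\varphi_k)|_P \mid \varphi_i\in\mathrm{Hom}_{\mathcal F_i}(\mathrm{pr}_i(P),\mathrm{pr}_i(Q)),\ (\varphi_1,\dots,\varphi_k)(P)\le Q\}$, $\mathrm{pr}_i$ being the projections. Fusion subsystems $\mathcal E_1,\dots,\mathcal E_k\le\mathcal F$ commute if there is a (necessarily unique) morphism $I\in\mathrm{Mor}(\mathcal E_1\times\cdots\times\mathcal E_k,\mathcal F)$ whose restriction to each factor is the inclusion. One writes $\mathcal F=\mathcal E_1\times\cdots\times\mathcal E_k$ if $\mathcal E_1,\dots,\mathcal E_k\le\mathcal F$ commute and $I$ is an isomorphism of fusion systems. A fusion system $\mathcal F$ over $S$ is indecomposable if there are no commuting fusion subsystems $\mathcal E_1,\mathcal E_2\le\mathcal F$ over proper subgroups $T_1,T_2<S$ with $\mathcal F=\mathcal E_1\times\mathcal E_2$.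
   Formalization: The formal theorem additionally assumes that at most one of the groups T_i is trivial; without this the claim fails, e.g. for S = 1, k = 2, E_1 = E_2 = F, where Γ = Σ_2 but Aut(F)/Aut^0(F) = 1. *)

(* Defs.v *)
From HB Require Import structures.
From mathcomp Require Import all_boot perm.
From mathcomp Require Import all_classical.

Set Implicit Arguments.
Unset Strict Implicit.
Unset Printing Implicit Defensive.

Local Open Scope group_scope.
Local Open Scope classical_set_scope.
Local Open Scope card_scope.

(* The possibly infinite groups below are subsets, satisfying [is_group], of  *)
(* a [groupType] (or of a [magmaType], where only the product matters).       *)

Definition is_group (G : groupType) (A : set G) : Prop :=
  A 1 /\ (forall x y, A x -> A y -> A (x * y^-1)).

Definition subgroup (G : groupType) (A B : set G) : Prop :=
  is_group A /\ A `<=` B.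

Definition generated (G : groupType) (A : set G) : set G :=
  smallest (@is_group G) A.

(* c_g; MathComp's x ^ g is g^-1 * x * g. *)
Definition cnj (G : groupType) (g : G) : G -> G := fun x => g * x * g^-1.

Definition normal (G : groupType) (N A : set G) : Prop :=
  subgroup N A /\ (forall g x, A g -> N x -> N (cnj g x)).

(* Subsets of a group are multiplied elementwise; on cosets of a normal       *)
(* subgroup this is the product of the quotient group.                        *)
Definition mul_set (G : groupType) (A B : set G) : set G :=
  [set x * y | x in A & y in B].

HB.instance Definition _ (G : groupType) := hasMul.Build (set G) (@mul_set G).

(* The set of left cosets g N with g in A. *)
Definition cosets (G : groupType) (A N : set G) : set (set G) :=
  [set [set g * n | n in N] | g in A].

Definition morphic (G H : magmaType) (A : set G) (B : set H) (f : G -> H) :=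
  set_fun A B f /\ {in A &, {morph f : x y / x * y}}.

Definition isog (G H : magmaType) (A : set G) (B : set H) : Prop :=
  exists f : G -> H, morphic A B f /\ set_bij A B f.

Definition semidirect (G : groupType) (A N K : set G) : Prop :=
  [/\ normal N A, subgroup K A, N `&` K = [set 1] & N * K = A].

Definition direct_prod (G : groupType) (r : nat) (A : 'I_r -> set G) :
  set {ffun 'I_r -> G} := [set x | forall i, A i (x i)].

(* The group of all permutations of a possibly infinite type, with            *)
(* (s * t) x = s (t x); on finite types, [{perm T}] has the opposite product. *)
Record sym (T : Type) := Sym {
  sym_fun :> T -> T;
  sym_inv : T -> T;
  symK : cancel sym_fun sym_inv;
  symVK : cancel sym_inv sym_fun }.

Section SymGroup.
Variable T : Type.
Implicit Types s t u : sym T.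

Lemma sym_eqP s t : s =1 t -> s = t.
Proof.
case: s t => [f f' fK f'K] [g g' gK g'K] /= /funext efg; subst g.
have /funext e' : f' =1 g' by move=> x; rewrite -{1}(g'K x) fK.
by subst g'; congr Sym; exact: Prop_irrelevance.
Qed.

Definition sym_one : sym T := @Sym T id id (fun=> erefl) (fun=> erefl).

Definition sym_mul s t : sym T :=
  Sym (can_comp (@symK _ s) (@symK _ t)) (can_comp (@symVK _ t) (@symVK _ s)).

Definition sym_invg s : sym T := Sym (@symVK _ s) (@symK _ s).

Lemma sym_mulA : associative sym_mul.
Proof. by move=> s t u; exact: sym_eqP. Qed.

Lemma sym_mul1 : left_id sym_one sym_mul.
Proof. by move=> s; exact: sym_eqP. Qed.

Lemma sym_mulr1 : right_id sym_one sym_mul.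
Proof. by move=> s; exact: sym_eqP. Qed.

Lemma sym_mulV : left_inverse sym_one sym_invg sym_mul.
Proof. by move=> s; apply: sym_eqP => x; exact: symK. Qed.

Lemma sym_mulrV : right_inverse sym_one sym_invg sym_mul.
Proof. by move=> s; apply: sym_eqP => x; exact: symVK. Qed.

HB.instance Definition _ := gen_eqMixin (sym T).
HB.instance Definition _ := gen_choiceMixin (sym T).
HB.instance Definition _ :=
  isGroup.Build (sym T) sym_mulA sym_mul1 sym_mulr1 sym_mulV sym_mulrV.

End SymGroup.

(* As for MathComp's [Aut], a bijection A -> A is encoded as the permutation  *)
(* of the whole type that agrees with it on A and is the identity off A.      *)
Definition sym_on (T : Type) (A : set T) : set (sym T) :=
  [set a | forall x, ~ A x -> a x = x].

(* A is a copy of Z/p^oo. *)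
Definition is_prufer (p : nat) (G : groupType) (A : set G) : Prop :=
  exists C : nat -> set G,
    [/\ forall n, C n `<=` C n.+1,
        forall n, (exists x, C n = generated [set x]) /\ C n #= `I_(p ^ n.+1)
      & A = \bigcup_n C n].

Definition discrete_toral (p : nat) (G : groupType) (S : set G) : Prop :=
  is_group S /\
  exists S0 : set G,
    [/\ normal S0 S,
        exists (r : nat) (U : groupType) (A : 'I_r -> set U),
          (forall i, is_prufer p (A i)) /\ isog S0 (direct_prod A)
      & exists n : nat, cosets S S0 #= `I_(p ^ n)].

(* Morphisms P -> Q are represented by total functions G -> G, two functions  *)
(* representing the same morphism when they agree on P.                       *)
Record fusion_data (G : groupType) := FusionData {
  fs_group : set G;
  fs_hom : set G -> set G -> (G -> G) -> Prop }.

Section Fusion.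
Variable G : groupType.
Implicit Types (E F : fusion_data G) (S P Q R : set G) (f g phi psi : G -> G).

Definition hom_inner S P Q phi : Prop :=
  exists g : G, [/\ S g, set_fun P Q (cnj g) & {in P, phi =1 cnj g}].

Definition fs_iso F P Q phi : Prop :=
  fs_hom F P Q phi /\
  exists psi, [/\ fs_hom F Q P psi,
                  {in P, cancel phi psi} & {in Q, cancel psi phi}].

Record fusion_system F : Prop := FusionSystem {
  fs_is_group : is_group (fs_group F);
  fs_obj : forall P Q phi, fs_hom F P Q phi ->
    subgroup P (fs_group F) /\ subgroup Q (fs_group F);
  fs_ext : forall P Q phi psi, {in P, phi =1 psi} ->
    fs_hom F P Q phi -> fs_hom F P Q psi;
  fs_id : forall P, subgroup P (fs_group F) -> fs_hom F P P id;
  fs_comp : forall P Q R phi psi,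
    fs_hom F P Q phi -> fs_hom F Q R psi -> fs_hom F P R (psi \o phi);
  fs_inner : forall P Q phi,
    subgroup P (fs_group F) -> subgroup Q (fs_group F) ->
    hom_inner (fs_group F) P Q phi -> fs_hom F P Q phi;
  fs_inj : forall P Q phi, fs_hom F P Q phi ->
    morphic P Q phi /\ set_inj P phi;
  fs_factor : forall P Q phi, fs_hom F P Q phi ->
    exists R, R `<=` Q /\ fs_iso F P R phi }.

Definition fs_conj F P Q : Prop := exists phi, fs_iso F P Q phi.

Definition fs_conj_elt F (x y : G) : Prop :=
  exists phi, fs_hom F (generated [set x]) (generated [set y]) phi /\ phi x = y.

Definition aut_fs F P : set (sym G) := [set a | sym_on P a /\ fs_iso F P P a].

Definition aut_inner S P : set (sym G) :=
  [set a | sym_on P a /\ hom_inner S P P a].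

Definition fully_automized (p : nat) F P : Prop :=
  exists n : nat,
    cosets (aut_fs F P) (aut_inner (fs_group F) P) #= `I_n /\ coprime n p.

(* N_phi for an isomorphism phi : Q -> P; the last equation says that a is    *)
(* phi c_g phi^-1 on P.                                                       *)
Definition ext_dom S Q P phi : set G :=
  [set g | [/\ S g, cnj g @` Q = Q &
    exists2 a : sym G, aut_inner S P a &
      {in Q, forall x, a (phi x) = phi (cnj g x)}]].

Definition receptive F P : Prop :=
  forall Q phi, fs_iso F Q P phi ->
    exists phib, fs_hom F (ext_dom (fs_group F) Q P phi) (fs_group F) phib /\
                 {in Q, phib =1 phi}.

Definition saturated (p : nat) F : Prop :=
  (forall P, subgroup P (fs_group F) ->
     exists Q, [/\ fs_conj F P Q, fully_automized p F Q & receptive F Q]) /\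
  (forall (P : nat -> set G) phi,
     (forall n, subgroup (P n) (fs_group F)) ->
     (forall n, P n `<=` P n.+1) ->
     morphic (\bigcup_n P n) (fs_group F) phi ->
     (forall n, fs_hom F (P n) (fs_group F) phi) ->
     fs_hom F (\bigcup_n P n) (fs_group F) phi).

Definition fs_central F P : Prop :=
  subgroup P (fs_group F) /\
  forall Q R phi, fs_hom F Q R phi ->
    exists phib, [/\ fs_hom F (Q * P) (R * P) phib,
                     {in Q, phib =1 phi} & {in P, phib =1 id}].

Definition fs_center F : set G :=
  generated (\bigcup_(P in [set P | fs_central F P]) P).

Definition focal F : set G :=
  generated [set z | exists x y, [/\ fs_group F x, fs_group F y,
                                     fs_conj_elt F x y & z = x * y^-1]].

Definition fusion_subsystem E F : Prop :=
  [/\ fusion_system E, fs_group E `<=` fs_group F &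
      forall P Q phi, fs_hom E P Q phi -> fs_hom F P Q phi].

End Fusion.

Section Morphisms.
Variables (G H : groupType).

(* Phi is the action on morphisms of a functor hat f from E to F which is     *)
(* P |-> f(P) on objects.                                                     *)
Record functor_along (E : fusion_data G) (F : fusion_data H) (f : G -> H)
    (Phi : set G -> set G -> (G -> G) -> (H -> H)) : Prop := FunctorAlong {
  fun_hom : forall P Q phi, fs_hom E P Q phi ->
    fs_hom F (f @` P) (f @` Q) (Phi P Q phi);
  fun_ext : forall P Q phi psi, fs_hom E P Q phi -> {in P, phi =1 psi} ->
    {in f @` P, Phi P Q phi =1 Phi P Q psi};
  fun_id : forall P, subgroup P (fs_group E) ->
    {in f @` P, Phi P P id =1 id};
  fun_comp : forall P Q R phi psi, fs_hom E P Q phi -> fs_hom E Q R psi ->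
    {in f @` P, Phi P R (psi \o phi) =1 Phi Q R psi \o Phi P Q phi};
  fun_along : forall P Q phi, fs_hom E P Q phi ->
    {in P, forall x, Phi P Q phi (f x) = f (phi x)} }.

(* As above, f matters only on the group of E. *)
Definition fs_mor (E : fusion_data G) (F : fusion_data H) (f : G -> H) : Prop :=
  morphic (fs_group E) (fs_group F) f /\ exists Phi, functor_along E F f Phi.

End Morphisms.

Definition fs_isomorphism (G H : groupType)
    (E : fusion_data G) (F : fusion_data H) (f : G -> H) : Prop :=
  fs_mor E F f /\
  exists g : H -> G, [/\ fs_mor F E g, {in fs_group E, cancel f g}
                       & {in fs_group F, cancel g f}].

Definition fs_isog (G H : groupType)
    (E : fusion_data G) (F : fusion_data H) : Prop :=
  exists f : G -> H, fs_isomorphism E F f.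

Definition Aut_fs (G : groupType) (F : fusion_data G) : set (sym G) :=
  [set a | sym_on (fs_group F) a /\ fs_isomorphism F F a].

Section Products.
Variables (G : groupType) (k : nat).
Implicit Types (E : 'I_k -> fusion_data G) (F : fusion_data G).

Definition pr (i : 'I_k) (x : {ffun 'I_k -> G}) : G := x i.

Definition prod_map (phi : 'I_k -> G -> G) (x : {ffun 'I_k -> G}) :
  {ffun 'I_k -> G} := [ffun i => phi i (x i)].

Definition fs_prod E : fusion_data {ffun 'I_k -> G} :=
  let T := direct_prod (fun i => fs_group (E i)) in
  FusionData T (fun P Q Phi =>
    [/\ subgroup P T, subgroup Q T &
        exists phi : 'I_k -> G -> G,
          [/\ forall i, fs_hom (E i) (pr i @` P) (pr i @` Q) (phi i),
              prod_map phi @` P `<=` Q & {in P, Phi =1 prod_map phi}]]).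

Definition factor_inj (i : 'I_k) (x : G) : {ffun 'I_k -> G} :=
  [ffun j => if j == i then x else 1].

(* E_1, ..., E_k commute in F when such an I exists. *)
Definition commuting_map E F (I : {ffun 'I_k -> G} -> G) : Prop :=
  fs_mor (fs_prod E) F I /\
  forall i, {in fs_group (E i), forall x, I (factor_inj i x) = x}.

(* F = E_1 x ... x E_k. *)
Definition direct_decomposition F E : Prop :=
  (forall i, fusion_subsystem (E i) F) /\
  exists I, commuting_map E F I /\ fs_isomorphism (fs_prod E) F I.

Definition Aut0_fs F E : set (sym G) :=
  [set a | Aut_fs F a /\
           forall i, a @` fs_group (E i) = fs_group (E i)].

Definition iso_perms E : set 'S_k :=
  [set s | forall i, fs_isog (E (s i)) (E i)].

End Products.

Definition indecomposable (G : groupType) (F : fusion_data G) : Prop :=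
  ~ exists E : 'I_2 -> fusion_data G,
      (forall i, fs_group (E i) `<` fs_group F) /\ direct_decomposition F E.

(* Main.v *)
Require Import Defs.
From mathcomp Require Import all_boot perm.
From mathcomp Require Import all_classical.

(** The heart of the matter is that every automorphism of F permutes the
    groups T_i of the factors.  Since each factor is the full subcategory of
    F on the subgroups of T_i ([factor_full]), this is a Krull-Schmidt
    uniqueness statement about the subgroups T_i, and its proof follows the
    one for groups with trivial centre and for perfect groups.

    A decomposition F = A x B is recorded by its two projections e, e' :
    S -> S, which are endomorphisms of the fusion system ([splits]).  Let
    (f, f') be the projections of another decomposition F = C x D.  An
    element of the intersection of e(f(S)) and e(f'(S)) is fixed by
    morphisms coming from C as well as by those coming from D, and one
    deduces that this intersection is central in F ([overlap_central]).
    Exchanging the two decompositions, the composite f' e f takes values in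
    a central subgroup, because f'(e y) f'(e' y) = f'(y) = 1 for y = f(x).
    If Z(F) = 1 it is trivial.  In general it is constant on F-conjugacy
    classes, as morphisms fix central elements, so it kills foc(F), and it
    is again trivial if foc(F) = S ([central_endomorphism_trivial],
    [cross_projection_trivial]).  Hence e and e' preserve f(S) and split the
    fusion system C; if C is indecomposable, then f(S) lies in e(S) or in
    e'(S) ([indecomposable_absorbed]).  Comparing the given decomposition
    with its image under an automorphism yields the permutation of the T_i
    ([Aut_factor_image]).

    Conversely, isomorphisms E_i -> E_(s i) between the factors glue to
    an automorphism of F ([glue_Aut]).  For s = 1 this identifies Aut^0(F)
    with the product of the groups Aut(E_i).  For general s, choosing the
    isomorphisms through one representative in each isomorphism class makes
    them compatible with composition, and gives a homomorphism from Gamma to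
    Aut(F) whose image K is a complement to Aut^0(F)
    ([factor_permutations]). *)

Local Open Scope group_scope.
Local Open Scope classical_set_scope.

Set Implicit Arguments.
Unset Strict Implicit.
Unset Printing Implicit Defensive.

(** * Subgroups and homomorphisms between subsets of groups *)

Section Subgroups.
Variables G H : groupType.
Implicit Types (A B C : set G) (D : set H) (f g : G -> H).

Lemma is_groupV A x : is_group A -> A x -> A x^-1.
Proof. by move=> [A1 AF] Ax; rewrite -[x^-1]mul1g; exact: AF. Qed.

Lemma is_groupM A x y : is_group A -> A x -> A y -> A (x * y).
Proof.
move=> gA Ax Ay; rewrite -[y]invgK; apply: gA.2 => //; exact: is_groupV.
Qed.

Lemma is_group1 A : is_group A -> A 1.
Proof. by case. Qed.

Lemma is_group_setI A B : is_group A -> is_group B -> is_group (A `&` B).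
Proof.
move=> [A1 AF] [B1 BF]; split=> // x y [? ?] [? ?].
by split; [exact: AF | exact: BF].
Qed.

Lemma is_group_trivial : is_group [set 1 : G].
Proof. by split=> // x y -> ->; rewrite mulgV. Qed.

Lemma generatedP A B : is_group B -> A `<=` B -> generated A `<=` B.
Proof. by move=> gB AB; exact: smallest_sub. Qed.

Lemma sub_generated A : A `<=` generated A.
Proof. by move=> x Ax B [_]; exact. Qed.

Lemma morphicM A D f x y : morphic A D f -> A x -> A y -> f (x * y) = f x * f y.
Proof. by move=> [_ fM] Ax Ay; apply: fM; exact: mem_set. Qed.

Lemma morphicP A D f : (forall x, A x -> D (f x)) ->
  (forall x y, A x -> A y -> f (x * y) = f x * f y) -> morphic A D f.
Proof. by move=> fD fM; split=> // x y /set_mem Ax /set_mem Ay; exact: fM. Qed.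

Lemma morphic1 A D f : is_group A -> morphic A D f -> f 1 = 1.
Proof.
move=> [A1 _] fm; apply: (@mulgI _ (f 1)).
by rewrite -(morphicM fm A1 A1) !mulg1.
Qed.

Lemma morphicV A D f x :
  is_group A -> morphic A D f -> A x -> f x^-1 = (f x)^-1.
Proof.
move=> gA fm Ax; apply: (@mulgI _ (f x)); have Ax' := is_groupV gA Ax.
by rewrite -(morphicM fm) // !mulgV (morphic1 gA fm).
Qed.

Lemma is_group_image A D f : is_group A -> morphic A D f -> is_group (f @` A).
Proof.
move=> gA fm; split=> [|_ _ [x Ax <-] [y Ay <-]].
  by exists 1; [exact: is_group1 | exact: morphic1 gA fm].
exists (x * y^-1); first exact: gA.2.
by rewrite (morphicM fm) ?(morphicV gA fm) //; exact: is_groupV.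
Qed.

Lemma is_group_preimage A D D' f : is_group A -> morphic A D f -> is_group D' ->
  is_group [set x | A x /\ D' (f x)].
Proof.
move=> gA fm gD; split=> [|x y [Ax Dx] [Ay Dy]].
  by split; [exact: is_group1 | rewrite (morphic1 gA fm); exact: gD.1].
split; first exact: gA.2.
rewrite (morphicM fm) ?(morphicV gA fm) //; first exact: gD.2.
exact: is_groupV.
Qed.

Lemma is_group_equalizer A D f g : is_group A -> morphic A D f ->
  morphic A D g -> is_group [set x | A x /\ f x = g x].
Proof.
move=> gA fm gm; split=> [|x y [Ax ex] [Ay ey]].
  by rewrite /= (morphic1 gA fm) (morphic1 gA gm); split=> //; exact: is_group1.
split; first exact: gA.2.
have Ay' := is_groupV gA Ay.
by rewrite (morphicM fm) // (morphicM gm) // (morphicV gA fm) //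
  (morphicV gA gm) // ex ey.
Qed.

Lemma morphicS A B D D' f : B `<=` A -> (forall x, B x -> D' (f x)) ->
  morphic A D f -> morphic B D' f.
Proof.
by move=> BA fD fm; apply: morphicP => // x y /BA Ax /BA Ay;
  exact: (morphicM fm).
Qed.

Lemma is_group_mul_set A B : is_group A -> is_group B ->
  (forall x y, A x -> B y -> commute x y) -> is_group (A * B).
Proof.
move=> gA gB cAB; split; first by exists 1; [exact: is_group1 | exists 1;
  [exact: is_group1 | rewrite mulg1]].
move=> _ _ [x Ax [y By <-]] [x' Ax' [y' By' <-]].
exists (x * x'^-1); first exact: gA.2.
exists (y * y'^-1); first exact: gB.2.
have -> : x * x'^-1 * (y * y'^-1) = x * (x'^-1 * (y * y'^-1)) by rewrite !mulgA.
rewrite (cAB _ _ (is_groupV gA Ax') (gB.2 _ _ By By')).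
by rewrite invgM !mulgA.
Qed.

End Subgroups.

Lemma morphic_comp (G H K : groupType) (A : set G) (B : set H) (C : set K)
    (f : G -> H) (g : H -> K) :
  morphic A B f -> morphic B C g -> morphic A C (g \o f).
Proof.
move=> fm gm; apply: morphicP => [x Ax|x y Ax Ay] /=.
  by apply: gm.1; exact: fm.1.
by rewrite (morphicM fm) // (morphicM gm) //; exact: fm.1.
Qed.

(** * Morphisms of fusion systems *)

Section FusionMaps.
Variables (G : groupType) (F : fusion_data G).
Hypothesis fsF : fusion_system F.
Local Notation S := (fs_group F).
Implicit Types (P Q R : set G) (phi psi : G -> G).

Lemma fs_maps P Q phi x : fs_hom F P Q phi -> P x -> Q (phi x).
Proof. by move=> /(fs_inj fsF)[[h _] _]; exact: h. Qed.

Lemma fs_dom P Q phi : fs_hom F P Q phi -> subgroup P S.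
Proof. by case/(fs_obj fsF). Qed.

Lemma fs_cod P Q phi : fs_hom F P Q phi -> subgroup Q S.
Proof. by case/(fs_obj fsF). Qed.

Lemma subgroup_refl : subgroup S S.
Proof. by split=> //; exact: fs_is_group. Qed.

Lemma fs_inclusion P Q :
  subgroup P S -> subgroup Q S -> P `<=` Q -> fs_hom F P Q id.
Proof.
move=> PS QS PQ; apply: fs_inner => //; exists 1.
have cnj1 x : cnj 1 x = x by rewrite /cnj invg1 mul1g mulg1.
split=> [|x /PQ|x _ /=]; rewrite ?cnj1 //.
exact: is_group1 (fs_is_group fsF).
Qed.

(** The source can be shrunk by composing with an inclusion; the target can be
    changed because the factorization axiom makes the corestriction to the
    image a morphism. *)
Lemma fs_restrict P Q P' Q' phi psi :
  fs_hom F P Q phi -> subgroup P' S -> P' `<=` P -> subgroup Q' S ->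
  (forall x, P' x -> Q' (psi x)) -> (forall x, P' x -> psi x = phi x) ->
  fs_hom F P' Q' psi.
Proof.
move=> hphi sP' P'P sQ' psiQ' e.
apply: (fs_ext fsF (phi := phi)); first by move=> x /set_mem/e ->.
have hP' : fs_hom F P' Q phi.
  exact: fs_comp (fs_inclusion sP' (fs_dom hphi) P'P) hphi.
have [R [RQ [hR [chi [hchi _ chiK]]]]] := fs_factor fsF hP'.
have RQ' : R `<=` Q'.
  move=> x Rx; rewrite -(chiK x (mem_set Rx)) /=.
  have P'x := fs_maps hchi Rx.
  by rewrite -e //; exact: psiQ'.
exact: fs_comp hR (fs_inclusion (fs_dom hchi) sQ' RQ').
Qed.

End FusionMaps.

(** A morphism of F with source P; by [fs_restrict] its target is immaterial. *)
Notation hom_on F P phi := (fs_hom F P (fs_group F) phi).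

Section Functors.
Variables (G H : groupType) (E : fusion_data G) (F : fusion_data H).
Implicit Types (P Q : set G) (phi : G -> G) (f : G -> H).

(** The functor is determined by the group homomorphism: the equation
    psi (f x) = f (phi x) fixes the image of phi on all of f(P), and
    functoriality follows from it.  Only closure properties of E enter, which
    makes the lemma applicable to a direct product before that is known to be a
    fusion system. *)
Lemma fs_mor_intro f :
  (forall P Q phi x, fs_hom E P Q phi -> P x -> Q (phi x)) ->
  (forall P Q phi psi, {in P, phi =1 psi} -> fs_hom E P Q phi ->
     fs_hom E P Q psi) ->
  (forall P, subgroup P (fs_group E) -> fs_hom E P P id) ->
  (forall P Q R phi psi, fs_hom E P Q phi -> fs_hom E Q R psi ->
     fs_hom E P R (psi \o phi)) ->
  morphic (fs_group E) (fs_group F) f ->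
  (forall P Q phi, fs_hom E P Q phi -> exists psi,
     fs_hom F (f @` P) (f @` Q) psi /\
     forall x, P x -> psi (f x) = f (phi x)) ->
  fs_mor E F f.
Proof.
move=> Emap Eext Eid Ecomp fm hf; split=> //.
have hf' (t : set G * set G * (G -> G)) : exists psi : H -> H,
    fs_hom E t.1.1 t.1.2 t.2 ->
    fs_hom F (f @` t.1.1) (f @` t.1.2) psi /\
    forall x, t.1.1 x -> psi (f x) = f (t.2 x).
  have [/hf[psi psiP]|nh] := EM (fs_hom E t.1.1 t.1.2 t.2); first by exists psi.
  by exists id.
have [Phi PhiP] := choice hf'.
exists (fun P Q phi => Phi (P, Q, phi)).
have along P Q phi x : fs_hom E P Q phi -> P x ->
    Phi (P, Q, phi) (f x) = f (phi x).
  by move=> /(PhiP (P, Q, phi))[_]; exact.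
split=> [P Q phi|P Q phi psi h e|P sP|P Q R phi psi h h'|P Q phi h x].
- by case/(PhiP (P, Q, phi)).
- move=> _ /set_mem[x Px <-]; rewrite (along _ _ _ _ h) //.
  by rewrite (along _ _ _ _ (Eext _ _ _ _ e h)) // (e x (mem_set Px)).
- by move=> _ /set_mem[x Px <-]; rewrite (along _ _ _ _ (Eid _ sP)).
- move=> _ /set_mem[x Px <-] /=;
    rewrite (along _ _ _ _ (Ecomp _ _ _ _ _ h h')) //.
  by rewrite (along _ _ _ _ h) // (along _ _ _ _ h') //; exact: Emap h Px.
- by move=> /set_mem; exact: along.
Qed.

Lemma fs_mor_hom f P Q phi : fs_mor E F f -> fs_hom E P Q phi ->
  exists psi, fs_hom F (f @` P) (f @` Q) psi /\
    forall x, P x -> psi (f x) = f (phi x).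
Proof.
move=> [_ [Phi PhiP]] h; exists (Phi P Q phi); split;
  first exact: (fun_hom PhiP h).
by move=> x Px; apply: (fun_along PhiP h); exact: mem_set.
Qed.

Hypothesis fsE : fusion_system E.

(** Functors can be tested on morphisms with target the whole group. *)
Lemma fs_morP f : fusion_system F ->
  fs_mor E F f <->
  morphic (fs_group E) (fs_group F) f /\
  (forall P phi, hom_on E P phi -> exists psi,
     hom_on F (f @` P) psi /\ forall x, P x -> psi (f x) = f (phi x)).
Proof.
move=> fsF; have sE := subgroup_refl fsE; have sF := subgroup_refl fsF; split.
  move=> mf; split=> [|P phi h]; first by case: mf.
  have [psi [h' e]] := fs_mor_hom mf h; exists psi; split=> //.
  have [_ sB] := fs_cod fsF h'.
  apply: (fs_restrict fsF h') => // [|x Px]; first exact: fs_dom h'.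
  by apply: sB; exact: fs_maps h' Px.
move=> [fm hf]; apply: fs_mor_intro => //.
- by move=> P Q phi x h; exact: (fs_maps fsE h).
- exact: fs_ext.
- exact: fs_id.
- exact: fs_comp.
move=> P Q phi h; have [sP sQ] := fs_obj fsE h.
have [|psi [hpsi psiE]] := hf P phi.
  apply: (fs_restrict fsE h) => // x Px; apply: sQ.2; exact: fs_maps h Px.
exists psi; split=> //; apply: (fs_restrict fsF hpsi) => //.
- exact: fs_dom hpsi.
- split; first apply: is_group_image sQ.1 _.
    by apply: morphicS (fm); [exact: sQ.2 | move=> x /sQ.2; exact: fm.1].
  by move=> _ [x /sQ.2 Ex <-]; exact: fm.1.
- move=> _ [x Px <-]; rewrite psiE //; exists (phi x) => //.
  exact: fs_maps h Px.
Qed.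

End Functors.

Section Category.
Variables G H K : groupType.
Variables (D : fusion_data G) (E : fusion_data H) (F : fusion_data K).
Hypotheses (fsD : fusion_system D) (fsE : fusion_system E)
  (fsF : fusion_system F).

Lemma fs_mor_id : fs_mor D D id.
Proof.
apply/fs_morP => //; split; first by apply: morphicP.
by move=> P phi h; exists phi; rewrite image_id.
Qed.

Lemma fs_mor_ext (f g : G -> H) :
  fs_mor D E f -> (forall x, fs_group D x -> g x = f x) -> fs_mor D E g.
Proof.
move=> /(fs_morP fsD _ fsE)[fm hf] e; apply/fs_morP => //; split.
  apply: morphicP => [x Dx|x y Dx Dy]; first by rewrite e //; exact: fm.1.
  rewrite !e ?(morphicM fm) //; exact: is_groupM (fs_is_group fsD) Dx Dy.
move=> P phi h; have [psi [hpsi psiE]] := hf P phi h.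
have sP := (fs_dom fsD h).2.
have eP x : P x -> g x = f x by move=> /sP; exact: e.
exists psi; split; first by rewrite (eq_imagel (f' := f)).
move=> x Px; rewrite eP // psiE // e //; exact: (fs_maps fsD h Px).
Qed.

Lemma fs_mor_comp (f : G -> H) (g : H -> K) :
  fs_mor D E f -> fs_mor E F g -> fs_mor D F (g \o f).
Proof.
move=> /(fs_morP fsD _ fsE)[fm hf] /(fs_morP fsE _ fsF)[gm hg].
apply/fs_morP => //; split; first exact: morphic_comp fm gm.
move=> P phi /hf[psi [/hg[chi [h e'] e]]].
exists chi; split; first by rewrite -image_comp.
by move=> x Px /=; rewrite e' ?e //; exists x.
Qed.

Lemma fs_isomorphism_refl : fs_isomorphism D D id.
Proof.
by split; [exact: fs_mor_id | exists id; split=> //; exact: fs_mor_id].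
Qed.

End Category.

Lemma fs_isomorphism_comp (G H K : groupType) (D : fusion_data G)
    (E : fusion_data H) (F : fusion_data K) (f : G -> H) (g : H -> K) :
  fusion_system D -> fusion_system E -> fusion_system F ->
  fs_isomorphism D E f -> fs_isomorphism E F g -> fs_isomorphism D F (g \o f).
Proof.
move=> fsD fsE fsF [mf [f' [mf' fK f'K]]] [mg [g' [mg' gK g'K]]].
split; first exact: fs_mor_comp mf mg.
exists (f' \o g'); split; first exact: fs_mor_comp mg' mf'.
- move=> x Dx /=; rewrite gK ?fK //; apply: mem_set.
  by apply: mf.1.1; exact: set_mem.
- move=> x Fx /=; rewrite f'K ?g'K //; apply: mem_set.
  by apply: mg'.1.1; exact: set_mem.
Qed.

(** * Automorphisms and full subsystems *)

Lemma Aut_fs_map (G : groupType) (F : fusion_data G) (a : sym G) x :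
  Aut_fs F a -> fs_group F x -> fs_group F (a x).
Proof. by move=> [_ [[[h _] _] _]]; exact: h. Qed.

Lemma Aut_fs_eq (G : groupType) (F : fusion_data G) (a b : sym G) :
  Aut_fs F a -> Aut_fs F b -> (forall x, fs_group F x -> a x = b x) -> a = b.
Proof.
move=> [a0 _] [b0 _] e; apply: sym_eqP => x.
by have [/e //|nx] := EM (fs_group F x); rewrite a0 // b0.
Qed.

Lemma sym_mulE (T : Type) (s t : sym T) x : (s * t) x = s (t x).
Proof. by []. Qed.

Lemma symKV (T : Type) (s : sym T) x : s (s^-1 x) = x.
Proof. exact: symVK. Qed.

Lemma symVKV (T : Type) (s : sym T) x : s^-1 (s x) = x.
Proof. exact: symK. Qed.

(** Off the group of F, the inverse permutation is the identity as well, so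
    that it represents the inverse isomorphism. *)
Lemma Aut_fs_inv (G : groupType) (F : fusion_data G) (a : sym G) :
  fusion_system F -> Aut_fs F a -> Aut_fs F (a^-1)%g.
Proof.
move=> fsF [a0 [ma [b [mb aK bK]]]].
have a'E x : fs_group F x -> (a^-1)%g x = b x.
  by move=> Fx; rewrite -{1}(bK x (mem_set Fx)) symVKV.
have ma' : fs_mor F F (a^-1)%g by exact: fs_mor_ext mb a'E.
split.
  move=> x nx; rewrite -{2}(symKV a x) a0 // => Fx.
  by apply: nx; rewrite -(symKV a x); exact: ma.1.1.
split=> //; exists a; split=> // x _; [exact: symKV|exact: symVKV].
Qed.

Lemma is_group_Aut_fs (G : groupType) (F : fusion_data G) :
  fusion_system F -> is_group (Aut_fs F).
Proof.
move=> fsF; split; first by split=> //; exact: fs_isomorphism_refl.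
move=> a b [a0 ia] /(Aut_fs_inv fsF)[b0 ib]; split.
  by move=> x nx; rewrite sym_mulE b0 // a0.
exact: fs_isomorphism_comp ib ia.
Qed.

(** An isomorphism F -> F is only determined on the group of F; extending it by
    the identity gives the element of the automorphism group. *)
Lemma Aut_fs_extend (G : groupType) (F : fusion_data G) (f : G -> G) :
  fusion_system F -> fs_isomorphism F F f ->
  exists a, Aut_fs F a /\ forall x, fs_group F x -> a x = f x.
Proof.
move=> fsF [mf [g [mg fK gK]]].
pose ext (h : G -> G) x := if x \in fs_group F then h x else x.
have extE h x : fs_group F x -> ext h x = h x.
  by move=> Fx; rewrite /ext mem_set.
have extN h x : ~ fs_group F x -> ext h x = x.
  by rewrite /ext; case: ifP => [/set_mem|].
have extK h h' : fs_mor F F h -> {in fs_group F, cancel h h'} ->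
    cancel (ext h) (ext h').
  move=> mh hK x; have [Fx|nx] := EM (fs_group F x); last by rewrite !extN.
  by rewrite (extE h) // extE ?hK //; [exact: mem_set | exact: mh.1.1].
pose a := Defs.Sym (extK _ _ mf fK) (extK _ _ mg gK).
have mext h : fs_mor F F h -> fs_mor F F (ext h).
  by move=> mh; apply: (fs_mor_ext fsF fsF mh) => x; exact: extE.
exists a; split; last by move=> x Fx; exact: (extE f).

split; first by move=> x; exact: (extN f).
split; first exact: mext mf.
exists (ext g); split; first exact: mext mg.
  by move=> x _; exact: (symK a).
by move=> x _; exact: (symVK a).
Qed.

Section Full.
Variables (G : groupType) (F : fusion_data G).
Hypothesis fsF : fusion_system F.
Implicit Types (E : fusion_data G) (T : set G).

Definition full T : fusion_data G :=
  FusionData T (fun P Q phi => [/\ P `<=` T, Q `<=` T & fs_hom F P Q phi]).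

Definition is_full E : Prop := forall P Q phi,
  fs_hom E P Q phi <->
  [/\ P `<=` fs_group E, Q `<=` fs_group E & fs_hom F P Q phi].

Lemma full_fusion_system T : subgroup T (fs_group F) -> fusion_system (full T).
Proof.
move=> [gT TS].
have sub P : subgroup P T -> subgroup P (fs_group F).
  by move=> [gP PT]; split=> //; exact: subset_trans PT TS.
split=> //=.
- move=> P Q phi [PT QT /(fs_obj fsF)[[gP _] [gQ _]]].
  by split.
- by move=> P Q phi psi e [PT QT h]; split=> //; exact: fs_ext fsF _ _ _ _ e h.
- by move=> P sP; split; [exact: sP.2|exact: sP.2|exact: fs_id (sub _ sP)].
- by move=> P Q R phi psi [PT QT h] [_ RT h']; split=> //; exact: fs_comp h h'.
- move=> P Q phi sP sQ [g [Tg gPQ e]]; split; [exact: sP.2|exact: sQ.2|].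
  apply: fs_inner; [exact: fsF|exact: sub|exact: sub|].
  by exists g; split=> //; exact: TS.
- by move=> P Q phi [_ _ /(fs_inj fsF)].
move=> P Q phi [PT QT /(fs_factor fsF)[R [RQ [h [psi [h' e e']]]]]].
have RT : R `<=` T by exact: subset_trans RQ QT.
by exists R; split=> //; split=> //; exists psi; split.
Qed.

Lemma full_subsystem T :
  subgroup T (fs_group F) -> fusion_subsystem (full T) F.
Proof.
move=> sT; split; [exact: full_fusion_system|exact: sT.2|by move=> P Q phi []].
Qed.

Lemma fs_mor_full E E' (f : G -> G) :
  fusion_subsystem E F -> is_full E -> fusion_subsystem E' F -> is_full E' ->
  fs_mor F F f -> (forall x, fs_group E x -> fs_group E' (f x)) ->
  fs_mor E E' f.
Proof.
move=> [fsE EF _] fullE [fsE' E'F _] fullE' /(fs_morP fsF _ fsF)[fm hf] fE.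
apply/fs_morP => //; split; first exact: morphicS EF fE fm.
move=> P phi h; have [PE _ hF] := (fullE _ _ _).1 h.
have [|psi [hpsi psiE]] := hf P phi.
  apply: (fs_restrict fsF hF) => //; first exact: fs_dom hF.
    exact: subgroup_refl.
  by move=> x Px; apply: EF; exact: (fs_maps fsE h Px).
have fPE' : f @` P `<=` fs_group E' by move=> _ [x /PE Ex <-]; exact: fE.
exists psi; split=> //; apply/fullE'; split=> //.
apply: (fs_restrict fsF hpsi) => //; first exact: fs_dom hpsi.
  by split=> //; exact: fs_is_group.
move=> _ [x Px <-]; rewrite psiE //; apply: fE; exact: (fs_maps fsE h Px).
Qed.

Lemma fs_isomorphism_full E E' (f g : G -> G) :
  fusion_subsystem E F -> is_full E -> fusion_subsystem E' F -> is_full E' ->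
  fs_mor F F f -> fs_mor F F g -> {in fs_group F, cancel f g} ->
  {in fs_group F, cancel g f} -> f @` fs_group E = fs_group E' ->
  fs_isomorphism E E' f.
Proof.
move=> sE fE sE' fE' mf mg fK gK e; have [_ EF _] := sE; have [_ E'F _] := sE'.
split; first by apply: fs_mor_full => // x Ex; rewrite -e; exists x.
exists g; split.
- apply: fs_mor_full => // y; rewrite -e => -[x Ex <-].
  by rewrite fK //; apply: mem_set; exact: EF.
- by move=> x /set_mem Ex; apply: fK; apply: mem_set; exact: EF.
- by move=> x /set_mem Ex; apply: gK; apply: mem_set; exact: E'F.
Qed.

End Full.

(** * Splittings of a fusion system by a pair of projections *)

Section Splittings.
Variables (G : groupType) (F : fusion_data G).
Hypothesis fsF : fusion_system F.
Local Notation S := (fs_group F).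
Implicit Types (P Q R : set G) (phi psi e f : G -> G).

Lemma hom_on_comp P1 P2 P phi psi chi :
  hom_on F P1 phi -> hom_on F P2 psi -> subgroup P S -> P `<=` P1 ->
  (forall x, P x -> P2 (phi x)) -> (forall x, P x -> chi x = psi (phi x)) ->
  hom_on F P chi.
Proof.
move=> h1 h2 sP PP1 phiP e; have sP2 := fs_dom fsF h2.
have h : hom_on F P (psi \o phi).
  by apply: fs_comp h2 => //; apply: (fs_restrict fsF h1).
apply: (fs_restrict fsF h) => //; first exact: subgroup_refl.
by move=> x Px; rewrite e //; exact: (fs_maps fsF h Px).
Qed.

Lemma hom_onW P Q phi : fs_hom F P Q phi -> hom_on F P phi.
Proof.
move=> h; have [sP [_ QS]] := fs_obj fsF h.
apply: (fs_restrict fsF h) => // [|x Px]; first exact: subgroup_refl.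
by apply: QS; exact: (fs_maps fsF h Px).
Qed.

(** A decomposition F = A x B, seen through the projections e and e' of S onto
    the groups of A and B.  Both are endomorphisms of F, and a morphism between
    subgroups of e(S) extends by the identity on e'(S), and symmetrically.  The
    group e(S) is the kernel of e', so that membership in it is written
    e' x = 1. *)
Record splits e e' : Prop := Splits {
  split_end : fs_mor F F e;
  split_endC : fs_mor F F e';
  split_mul : forall x, S x -> e x * e' x = x;
  split_ann : forall x, S x -> e' (e x) = 1;
  split_annC : forall x, S x -> e (e' x) = 1;
  split_ext : forall P phi, hom_on F P phi -> (forall x, P x -> e' x = 1) ->
    (forall x, P x -> e' (phi x) = 1) ->
    hom_on F [set x | S x /\ P (e x)] (fun x => phi (e x) * e' x);
  split_extC : forall P phi, hom_on F P phi -> (forall x, P x -> e x = 1) ->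
    (forall x, P x -> e (phi x) = 1) ->
    hom_on F [set x | S x /\ P (e' x)] (fun x => phi (e' x) * e x) }.

Lemma end_map e x : fs_mor F F e -> S x -> S (e x).
Proof. by move=> [[h _] _]; exact: h. Qed.

Lemma endM e x y : fs_mor F F e -> S x -> S y -> e (x * y) = e x * e y.
Proof. by move=> [m _]; exact: (morphicM m). Qed.

Lemma end1 e : fs_mor F F e -> e 1 = 1.
Proof. by move=> [m _]; exact: (morphic1 (fs_is_group fsF) m). Qed.

Lemma end_hom e P phi : fs_mor F F e -> hom_on F P phi ->
  exists psi, hom_on F (e @` P) psi /\ forall x, P x -> psi (e x) = e (phi x).
Proof. by move=> /(fs_morP fsF _ fsF)[_ h] /h. Qed.

(** With u = e x and v = e' y, the product v u has components u and v, so the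
    splitting of v u reads u v = v u. *)
Lemma split_commute e e' x y :
  splits e e' -> S x -> S y -> commute (e x) (e' y).
Proof.
move=> sp Sx Sy; have [me me'] := (split_end sp, split_endC sp).
have [Sex Sey] := (end_map me Sx, end_map me' Sy).
have idem z : S z -> e (e z) = e z.
  by move=> Sz; rewrite -{2}(split_mul sp (end_map me Sz)) (split_ann sp) //
    mulg1.
have idem' z : S z -> e' (e' z) = e' z.
  by move=> Sz; rewrite -{2}(split_mul sp (end_map me' Sz)) (split_annC sp) //
    mul1g.
have Syx : S (e' y * e x) by exact: is_groupM (fs_is_group fsF) Sey Sex.
rewrite /commute -(split_mul sp Syx) !(endM me, endM me') //.
by rewrite (split_ann sp) // (split_annC sp) // mul1g mulg1 idem // idem'.
Qed.

Lemma splits_sym e e' : splits e e' -> splits e' e.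
Proof.
move=> sp; split; [exact: split_endC sp|exact: split_end sp| | | | |].
- by move=> x Sx; rewrite -(split_commute sp) // (split_mul sp).
- exact: split_annC sp.
- exact: split_ann sp.
- exact: split_extC sp.
- exact: split_ext sp.
Qed.

Lemma split_idem e e' x : splits e e' -> S x -> e (e x) = e x.
Proof.
move=> sp Sx; have Sex := end_map (split_end sp) Sx.
by rewrite -{2}(split_mul sp Sex) (split_ann sp) // mulg1.
Qed.

Lemma split_fixed e e' x : splits e e' -> S x -> e' x = 1 -> e x = x.
Proof. by move=> sp Sx e1; rewrite -{2}(split_mul sp Sx) e1 mulg1. Qed.

(** Extend phi1 by the identity of e(S) and phi0 by the identity of e'(S), and
    compose. *)
Lemma split_prod e e' P0 P1 phi0 phi1 : splits e e' ->
  hom_on F P0 phi0 -> (forall x, P0 x -> e' x = 1) ->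
  (forall x, P0 x -> e' (phi0 x) = 1) ->
  hom_on F P1 phi1 -> (forall x, P1 x -> e x = 1) ->
  (forall x, P1 x -> e (phi1 x) = 1) ->
  hom_on F [set x | [/\ S x, P0 (e x) & P1 (e' x)]]
    (fun x => phi0 (e x) * phi1 (e' x)).
Proof.
move=> sp h0 k0 l0 h1 k1 l1; have gS := fs_is_group fsF.
have [[m0 m1] sp'] := (split_end sp, split_endC sp, splits_sym sp).
have phi1S x : P1 x -> S (phi1 x) by exact: (fs_maps fsF h1).
apply: (hom_on_comp (split_extC sp h1 k1 l1) (split_ext sp h0 k0 l0)).
- split=> [|x []] //.
  have g1 := is_group_preimage gS m0.1 (fs_dom fsF h0).1.
  have g2 := is_group_preimage gS m1.1 (fs_dom fsF h1).1.
  have := is_group_setI g1 g2; congr is_group.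
  by apply/seteqP; split=> [x [[? ?] [? ?]]|x [? ? ?]].
- by move=> x [].
- move=> x [Sx P0x P1x]; have [Sex Sp] := (end_map m0 Sx, phi1S _ P1x).
  split; first exact: is_groupM.
  by rewrite (endM m0) // l1 // mul1g (split_idem sp).
move=> x [Sx P0x P1x]; have [Sex Sp] := (end_map m0 Sx, phi1S _ P1x).
rewrite (endM m0) // l1 // mul1g (split_idem sp) //.
by rewrite (endM m1) // (split_ann sp) // mulg1 (split_fixed sp' Sp) ?l1.

Qed.

End Splittings.

Section TwoSplittings.
Variables (G : groupType) (F : fusion_data G) (e e' f f' : G -> G).
Hypothesis fsF : fusion_system F.
Hypotheses (spe : splits F e e') (spf : splits F f f').
Local Notation S := (fs_group F).
Implicit Types (P Q R : set G) (phi psi : G -> G).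

Let me : fs_mor F F e := split_end spe.
Let me' : fs_mor F F e' := split_endC spe.
Let mf : fs_mor F F f := split_end spf.
Let mf' : fs_mor F F f' := split_endC spf.
Let gS := fs_is_group fsF.

(** For projections onto the factors of F = A x B and F = C x D, the images of
    the groups of C and D in A commute and generate the group of A, so that A is
    a quotient of C x D; the overlap measures its failure to be their direct
    product. *)
Definition overlap : set G := (e \o f) @` S `&` (e \o f') @` S.

Lemma overlap_sub z : overlap z -> S z.
Proof. by move=> [[c Sc <-] _] /=; do 2!apply: end_map => //. Qed.

Lemma overlap_left z : overlap z -> e' z = 1.
Proof.
by move=> [[c Sc <-] _] /=; rewrite (split_ann spe) //; exact: end_map.
Qed.

Lemma is_group_overlap : is_group overlap.
Proof.
have mef h : fs_mor F F h -> morphic S S (e \o h).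
  by move=> [mh _]; exact: morphic_comp mh me.1.
by apply: is_group_setI; apply: is_group_image gS (mef _ _).
Qed.

Lemma subgroup_overlap : subgroup overlap S.
Proof. by split; [exact: is_group_overlap | exact: overlap_sub]. Qed.

(** As an element of e(f'(S)), z commutes with e(f(S)); as an element of
    e(f(S)), with e(f'(S)).  These generate e(S), and e(S) commutes with
    e'(S). *)
Lemma overlap_commute z x : overlap z -> S x -> commute x z.
Proof.
move=> Zz Sx; have Sex := end_map me Sx.
have eS y : S y -> commute (e y) z.
  move=> Sy; rewrite -(split_mul spf Sy) (endM me); try exact: end_map.
  have [Sfy Sf'y] := (end_map mf Sy, end_map mf' Sy).
  case: Zz => [[c Sc ec] [d Sd ed]]; apply: commute_sym.
  apply: commuteM.
    rewrite -ed /commute /= -!(endM me) //; try exact: end_map.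
    by rewrite (split_commute fsF spf Sy Sd).
  rewrite -ec /commute /= -!(endM me) //; try exact: end_map.
  by rewrite (split_commute fsF spf Sc Sy).
have e'S : commute (e' x) z.
  rewrite -(split_fixed spe (overlap_sub Zz) (overlap_left Zz)).
  by apply: commute_sym; apply: (split_commute fsF spe) => //;
    exact: overlap_sub.
rewrite -(split_mul spe Sx); apply: commute_sym; apply: commuteM.
  by apply: commute_sym; exact: eS.
exact: commute_sym.
Qed.

Lemma subgroup_mul_overlap P : subgroup P S -> subgroup (P * overlap) S.
Proof.
move=> [gP PS]; split.
  apply: is_group_mul_set gP is_group_overlap _ => x z /PS Sx Zz.
  exact: overlap_commute.
move=> _ [x /PS Sx [z /overlap_sub Sz <-]]; exact: is_groupM.
Qed.

(** Let phi live in the factor e(S), with components phi_C and phi_D for the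
    splitting (f, f').  The e-images of phi_C x id and id x phi_D are morphisms
    of F, and each fixes the overlap: the former fixes e(f'(S)), the latter
    e(f(S)).  Their composite extends phi. *)
Lemma overlap_extend_left P phi : hom_on F P phi ->
  (forall x, P x -> e' x = 1) -> (forall x, P x -> e' (phi x) = 1) ->
  exists psi, hom_on F (P * overlap) psi /\
    forall x z, P x -> overlap z -> psi (x * z) = phi x * z.
Proof.
move=> h eP ephiP; have sP := fs_dom fsF h; have PS := sP.2.
have [phiC [hC eC]] := end_hom fsF mf h.
have [phiD [hD eD]] := end_hom fsF mf' h.
have phiS x : P x -> S (phi x) by exact: (fs_maps fsF h).
have fixe x : S x -> e' x = 1 -> e x = x by exact: split_fixed.
have {}hC := split_ext spf hC.
have {}hC := end_hom fsF me (hC _ _).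
have [||chiC [{}hC {}eCC]] := hC.
- by move=> _ [x /PS Sx <-]; exact: (split_ann spf).
- by move=> _ [x Px <-]; rewrite eC // (split_ann spf) //; exact: phiS.
have {}hD := split_extC spf hD.
have {}hD := end_hom fsF me (hD _ _).
have [||chiD [{}hD {}eDD]] := hD.
- by move=> _ [x /PS Sx <-]; exact: (split_annC spf).
- by move=> _ [x Px <-]; rewrite eD // (split_annC spf) //; exact: phiS.
(* With z = e (f c) = e (f' d), the element x z = e (x (f c)) is sent by chiD to
   e y, where y = f x * f' (phi x) * f' d, and chiC sends e y to phi x * z. *)
have comp x z : P x -> overlap z -> exists y,
    [/\ (e @` [set x | S x /\ (f' @` P) (f' x)]) (x * z),
        chiD (x * z) = e y, S y /\ (f @` P) (f y) & chiC (e y) = phi x * z].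
  move=> Px Zz; have Sx := PS _ Px; have Sp := phiS _ Px.
  case: (Zz) => [[c Sc ec] [d Sd ed]]; rewrite /= in ec ed.
  have [Sfc Sfd] := (end_map mf Sc, end_map mf' Sd).
  have [Sfx Sfp] := (end_map mf Sx, end_map mf' Sp).
  have Dx : S (x * f c) /\ (f' @` P) (f' (x * f c)).
    split; first exact: is_groupM.
    by exists x => //; rewrite (endM mf') // (split_ann spf) // mulg1.
  have xz : x * z = e (x * f c).
    by rewrite (endM me) // ec fixe //; exact: eP.
  exists (f x * (f' (phi x) * f' d)).
  have Sy : S (f x * (f' (phi x) * f' d)).
    by apply: is_groupM => //; exact: is_groupM.
  have fy : f (f x * (f' (phi x) * f' d)) = f x.
    rewrite (endM mf) // ?(split_idem spf) //; last exact: is_groupM.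
    by rewrite (endM mf) // !(split_annC spf) // !mulg1.
  have f'y : f' (f x * (f' (phi x) * f' d)) = f' (phi x) * f' d.
    rewrite (endM mf') // ?(split_ann spf) ?mul1g //; last exact: is_groupM.
    by rewrite (endM mf') // !(split_idem (splits_sym fsF spf)).
  split.
  - by rewrite xz; exists (x * f c).
  - rewrite xz eDD //.
    have -> : f' (x * f c) = f' x by rewrite (endM mf') // (split_ann spf) //
      mulg1.
    have -> : f (x * f c) = f x * f c by rewrite (endM mf) // (split_idem spf).
    rewrite eD // !(endM me) //; try (by apply: is_groupM).
    rewrite ec ed.
    rewrite mulgA [RHS]mulgA -!(endM me) //.
    by rewrite (split_commute fsF spf Sx Sp).
  - by split=> //; rewrite fy; exists x.
  - rewrite eCC //; last by split=> //; rewrite fy; exists x.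
    rewrite fy f'y eC // mulgA (split_mul spf) // (endM me) // ed fixe //.
    exact: ephiP.
exists (chiC \o chiD); split; last first.
  by move=> x z Px Zz /=; have [y [_ -> _ ->]] := comp x z Px Zz.
apply: (hom_on_comp fsF hD hC) => //; first exact: subgroup_mul_overlap.
- by move=> _ [x Px [z Zz <-]]; have [y []] := comp x z Px Zz.
- move=> _ [x Px [z Zz <-]]; have [y [_ -> [Sy fy] _]] := comp x z Px Zz.
  by exists y.
Qed.

(** An arbitrary morphism is the product of its components for (e, e'); the
    second component is extended by the identity on e(S), which contains the
    overlap. *)
Lemma overlap_central : fs_central F overlap.
Proof.
split; first exact: subgroup_overlap.
move=> Q R phi h0; have sQ := fs_dom fsF h0; have sR := fs_cod fsF h0.
have h := hom_onW fsF h0.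
have phiS x : Q x -> S (phi x) by exact: (fs_maps fsF h).
have QS := sQ.2.
have [phiA [hA eA]] := end_hom fsF me h.
have [phiB [hB eB]] := end_hom fsF me' h.
have [||psiA [{}hA eAA]] := overlap_extend_left hA.
- by move=> _ [x /QS Sx <-]; exact: (split_ann spe).
- by move=> _ [x Qx <-]; rewrite eA // (split_ann spe) //; exact: phiS.
pose chi x := psiA (e x) * phiB (e' x).
have {}hA : hom_on F [set x |
    [/\ S x, mul_set (e @` Q) overlap (e x) & (e' @` Q) (e' x)]] chi.
  apply: (split_prod fsF spe hA _ _ hB).
  - move=> _ [_ [x /QS Sx <-] [z Zz <-]]; have Sex := end_map me Sx.
    rewrite (endM me') ?(overlap_left Zz) ?mulg1 ?(split_ann spe) //.
    exact: overlap_sub.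
  - move=> _ [_ [x Qx <-] [z Zz <-]].
    have Sp := phiS _ Qx; have Sep := end_map me Sp.
    rewrite eAA ?eA //.
    rewrite (endM me') ?(overlap_left Zz) ?mulg1 ?(split_ann spe) //.
    exact: overlap_sub.
  - by move=> _ [x /QS Sx <-]; exact: (split_annC spe).
  - by move=> _ [x Qx <-]; rewrite eB // (split_annC spe) //; exact: phiS.
have eM x z : Q x -> overlap z -> e (x * z) = e x * z.
  move=> /QS Sx Zz; have Sz := overlap_sub Zz.
  by rewrite (endM me) // (split_fixed spe Sz (overlap_left Zz)).
have e'M x z : Q x -> overlap z -> e' (x * z) = e' x.
  move=> /QS Sx Zz; have Sz := overlap_sub Zz.
  by rewrite (endM me') // (overlap_left Zz) // mulg1.
have ext x z : Q x -> overlap z -> chi (x * z) = phi x * z.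
  move=> Qx Zz; have Sp := phiS _ Qx; have Se'p := end_map me' Sp.
  rewrite /chi eM // e'M // eAA // eA // eB //.
  rewrite -mulgA -(overlap_commute Zz Se'p : _ * z = z * _).
  by rewrite mulgA (split_mul spe).
have Z1 : overlap 1 by exact: is_group1 is_group_overlap.
have Q1 x : Q x -> chi x = phi x.
  by move=> Qx; rewrite -[x in LHS]mulg1 ext ?mulg1.
exists chi; split; [|by move=> x /set_mem; exact: Q1|]; last first.
  move=> z /set_mem Zz; rewrite -[z in LHS]mul1g ext //;
    last exact: is_group1 sQ.1.
  by rewrite (morphic1 sQ.1 (fs_inj fsF h).1) mul1g.
have sQZ := subgroup_mul_overlap sQ; have sRZ := subgroup_mul_overlap sR.
apply: (fs_restrict fsF hA) => // _ [x Qx [z Zz <-]].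
  split; rewrite ?eM ?e'M //; first by apply: sQZ.2; exists x => //; exists z.
  by exists (e x) => //; exists z.
rewrite ext //; exists (phi x); first exact: (fs_maps fsF h0 Qx).
by exists z.
Qed.

End TwoSplittings.

(** * Uniqueness of the projections *)

(** Conjugate elements have the same image under h, because the morphism induced
    on the images is defined on a subgroup of Z, and by centrality of Z it
    extends to a morphism that is the identity on Z.  Hence h kills the focal
    subgroup. *)
Lemma central_endomorphism_trivial (G : groupType) (F : fusion_data G)
    (Z : set G) (h : G -> G) :
  fusion_system F -> fs_center F = [set 1] \/ focal F = fs_group F ->
  fs_mor F F h -> fs_central F Z -> (forall x, fs_group F x -> Z (h x)) ->
  forall x, fs_group F x -> h x = 1.
Proof.
move=> fsF hF mh cZ hZ x Sx; case: hF => [Z1|focS].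
  have : fs_center F (h x) by apply: sub_generated; exists Z => //; exact: hZ.
  by rewrite Z1.
have gS := fs_is_group fsF.
have gK := is_group_preimage gS mh.1 (is_group_trivial G).
move: Sx; rewrite -focS => /(generatedP gK)[] //.
move=> _ [y [y' [Sy Sy' [phi [hphi e]] ->]]].
have Sy'' := is_groupV gS Sy'.
split; first exact: is_groupM.
rewrite (endM mh) // (morphicV gS mh.1) //.
suff -> : h y' = h y by rewrite mulgV.
have hphi' := hom_onW fsF hphi.
have yy : generated [set y] y by apply: sub_generated.
have [psi [/cZ.2[psib [_ psibE psib1]] psiE]] := end_hom fsF mh hphi'.
have e1 : psib (h y) = psi (h y) by apply: psibE; apply: mem_set; exists y.
have e2 : psib (h y) = h y by apply: psib1; apply: mem_set; exact: hZ.
by rewrite -e -psiE // -e1.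
Qed.

(** The composite f' e f maps S into the overlap of f'(e(S)) and f'(e'(S)),
    which is central. *)
Lemma cross_projection_trivial (G : groupType) (F : fusion_data G)
    (e e' f f' : G -> G) :
  fusion_system F -> fs_center F = [set 1] \/ focal F = fs_group F ->
  splits F e e' -> splits F f f' ->
  forall x, fs_group F x -> f' (e (f x)) = 1.
Proof.
move=> fsF hF spe spf.
have [me mf mf'] := And3 (split_end spe) (split_end spf) (split_endC spf).
have me' := split_endC spe; have gS := fs_is_group fsF.
have cZ := overlap_central fsF (splits_sym fsF spf) spe.
apply: (central_endomorphism_trivial (h := f' \o (e \o f)) fsF hF _ cZ).
  have mef := fs_mor_comp fsF fsF fsF mf me; exact: fs_mor_comp mef mf'.
(* f x is killed by f' and is the product of its e and e' components, so the
   f'-images of these are inverse to each other. *)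
move=> x Sx; have Sy := end_map mf Sx; split; first by exists (f x).
exists (f x)^-1; first exact: is_groupV.
have [Sey Se'y] := (end_map me Sy, end_map me' Sy).
rewrite /= !(morphicV gS me'.1, morphicV gS mf'.1) //.
apply: (@mulIg _ (f' (e' (f x)))); rewrite mulVg -(endM mf') //.
by rewrite (split_mul spe) // (split_ann spf).
Qed.

(** * Direct decompositions *)

Section Products.
Variables (G : groupType) (k : nat) (E : 'I_k -> fusion_data G).
Hypothesis fsE : forall i, fusion_system (E i).
Implicit Types P Q : set {ffun 'I_k -> G}.

Lemma morphic_pr (A : 'I_k -> set G) i :
  morphic (direct_prod A) (A i) (@pr G k i).
Proof.
by apply: morphicP => [x|x y _ _]; [exact | rewrite /pr ffunE].
Qed.

Lemma is_group_direct_prod (A : 'I_k -> set G) :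
  (forall i, is_group (A i)) -> is_group (direct_prod A).
Proof.
move=> gA; split=> [i|x y Ax Ay i]; first by rewrite ffunE; exact: is_group1.
by rewrite !ffunE; apply: (gA i).2; [exact: Ax | exact: Ay].
Qed.

Lemma subgroup_pr P i : subgroup P (fs_group (fs_prod E)) ->
  subgroup (@pr G k i @` P) (fs_group (E i)).
Proof.
move=> [gP PT]; split; last by move=> _ [x /PT Tx <-]; exact: Tx.
have m : morphic P (fs_group (E i)) (@pr G k i).
  by apply: (morphicS PT _ (morphic_pr _ i)) => x /PT.
exact: is_group_image gP m.
Qed.

Lemma fs_prod_map P Q phi x : fs_hom (fs_prod E) P Q phi -> P x -> Q (phi x).
Proof.
move=> [_ _ [phis [_ PQ e]]] Px; rewrite e; last exact: mem_set.
by apply: PQ; exists x.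
Qed.

Lemma fs_prod_mor_intro (H : groupType) (F : fusion_data H)
    (f : {ffun 'I_k -> G} -> H) :
  morphic (fs_group (fs_prod E)) (fs_group F) f ->
  (forall P Q phi, fs_hom (fs_prod E) P Q phi -> exists psi,
     fs_hom F (f @` P) (f @` Q) psi /\
     forall x, P x -> psi (f x) = f (phi x)) ->
  fs_mor (fs_prod E) F f.
Proof.
apply: fs_mor_intro.
- by move=> P Q phi x; exact: fs_prod_map.
- move=> P Q phi psi e [sP sQ [phis [h PQ e']]]; split=> //.
  by exists phis; split=> // x Px; rewrite -e // e'.
- move=> P sP; split=> //; exists (fun=> id); split.
  + by move=> i; apply: fs_id => //; exact: subgroup_pr.
  + by move=> _ [x Px <-]; have -> : prod_map (fun=> id) x = x
      by apply/ffunP => i; rewrite ffunE.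
  + by move=> x _; apply/ffunP => i; rewrite ffunE.
move=> P Q R phi psi [sP sQ [phis [h PQ e]]] [_ sR [psis [h' QR e']]].
split=> //; exists (fun i => psis i \o phis i).
have eM x : P x -> prod_map (fun i => psis i \o phis i) x =
    prod_map psis (prod_map phis x).
  by move=> Px; apply/ffunP => i; rewrite !ffunE.
split.
- by move=> i; exact: fs_comp (h i) (h' i).
- move=> _ [x Px <-]; rewrite eM //; apply: QR; exists (prod_map phis x) => //.
  by apply: PQ; exists x.
- move=> x /set_mem Px; rewrite eM //= e ?e' //; apply: mem_set => //.
  by apply: PQ; exists x.
Qed.

End Products.

Section SplitDecomposition.
Variables (G : groupType) (F : fusion_data G) (e e' : G -> G).
Hypothesis fsF : fusion_system F.
Hypothesis sp : splits F e e'.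
Local Notation S := (fs_group F).

Definition split_group (i : 'I_2) : set G :=
  [set x | S x /\ (if i == ord0 then e' x else e x) = 1].

Let me : fs_mor F F e := split_end sp.
Let me' : fs_mor F F e' := split_endC sp.
Let gS := fs_is_group fsF.
Let prj (i : 'I_2) := if i == ord0 then e else e'.
Let I (x : {ffun 'I_2 -> G}) : G := x ord0 * x ord_max.
Let J (x : G) : {ffun 'I_2 -> G} := [ffun i => prj i x].

Lemma subgroup_split_group i : subgroup (split_group i) S.
Proof.
split; last by move=> x [].
have m := if i == ord0 as b return
    morphic S S (fun x => if b then e' x else e x) then me'.1 else me.1.
exact: is_group_preimage gS m (is_group_trivial G).
Qed.

Let T := direct_prod split_group.

Let prj_group i x : S x -> split_group i (prj i x).
Proof.
rewrite /prj /split_group /= => Sx; case: ifP => _.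
  by split; [exact: end_map | exact: (split_ann sp)].
by split; [exact: end_map | exact: (split_annC sp)].
Qed.

Let T0 x : T x -> S (x ord0) /\ e' (x ord0) = 1.
Proof. exact. Qed.

Let T1 x : T x -> S (x ord_max) /\ e (x ord_max) = 1.
Proof. exact. Qed.

Let eI x : T x -> e (I x) = x ord0.
Proof.
move=> Tx; have [[S0 e0] [S1 e1]] := (T0 Tx, T1 Tx).
by rewrite (endM me) // e1 mulg1 (split_fixed sp).
Qed.

Let e'I x : T x -> e' (I x) = x ord_max.
Proof.
move=> Tx; have [[S0 e0] [S1 e1]] := (T0 Tx, T1 Tx).
by rewrite (endM me') // e0 mul1g (split_fixed (splits_sym fsF sp)).
Qed.

Let IK x : T x -> J (I x) = x.
Proof.
move=> Tx; apply/ffunP => i; rewrite ffunE /prj.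
case: eqP => [->|/eqP i0]; first exact: eI.
rewrite e'I //; congr (x _); apply: val_inj.
by case: i i0 => [[|[|]]].
Qed.

Let JK x : S x -> I (J x) = x.
Proof. by move=> Sx; rewrite /I !ffunE; exact: (split_mul sp). Qed.

Let JT x : S x -> T (J x).
Proof. by move=> Sx i; rewrite ffunE; exact: prj_group. Qed.

Let IS x : T x -> S (I x).
Proof. by move=> Tx; exact: is_groupM (T0 Tx).1 (T1 Tx).1. Qed.

Let morphicI : morphic T S I.
Proof.
apply: morphicP => // x y Tx Ty; rewrite /I !ffunE -!mulgA; congr (_ * _).
rewrite !mulgA; congr (_ * _).
have [[S0 e0] [S1 e1]] := (T0 Ty, T1 Tx).
have := split_commute fsF sp S0 S1.
by rewrite (split_fixed sp) // (split_fixed (splits_sym fsF sp)).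
Qed.

Let morphicJ : morphic S T J.
Proof.
apply: morphicP => // x y Sx Sy; apply/ffunP => i; rewrite !ffunE /prj.
by case: (i == ord0); [exact: (endM me) | exact: (endM me')].
Qed.

Let factors := fun i : 'I_2 => full F (split_group i).

Let fs_factors i : fusion_system (factors i).
Proof. exact: full_fusion_system (subgroup_split_group i). Qed.

Let fs_mor_I : fs_mor (fs_prod factors) F I.
Proof.
apply: fs_prod_mor_intro => // P Q Phi h.
have [sP sQ [phi [hphi PQ ePhi]]] := h.
have [/=P0 Q0 h0] := hphi ord0; have [/=P1 Q1 h1] := hphi ord_max.
have hprod : hom_on F
    [set x | [/\ S x,
      (@pr G 2 ord0 @` P) (e x) & (@pr G 2 ord_max @` P) (e' x)]]
    (fun x => phi ord0 (e x) * phi ord_max (e' x)).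
  apply: (split_prod fsF sp (hom_onW fsF h0) _ _ (hom_onW fsF h1)).
  - by move=> x /P0[].
  - by move=> x Px; have [] := Q0 _ (fs_maps fsF h0 Px).
  - by move=> x /P1[].
  - by move=> x Px; have [] := Q1 _ (fs_maps fsF h1 Px).
have PT := sP.2; have QT := sQ.2.
exists (fun x => phi ord0 (e x) * phi ord_max (e' x)).
have psiE x : P x -> phi ord0 (e (I x)) * phi ord_max (e' (I x)) = I (Phi x).
  move=> Px; rewrite eI ?e'I //; try exact: PT.
  by rewrite ePhi /I ?ffunE //; exact: mem_set.
split=> //.
have subI R : subgroup R T -> subgroup (I @` R) S.
  move=> [gR RT]; split; last by move=> _ [x /RT Tx <-]; exact: IS.
  by apply: is_group_image gR (morphicS RT _ morphicI) => x /RT; exact: IS.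
apply: (fs_restrict fsF hprod) => //; first exact: subI; last 2 first.
- exact: subI.
- move=> _ [x Px <-]; rewrite psiE //; exists (Phi x) => //.
  exact: fs_prod_map h Px.
move=> _ [x Px <-]; have Tx := PT _ Px.
split; first exact: IS.
  by rewrite eI //; exists x.
by rewrite e'I //; exists x.
Qed.

Let fs_mor_J : fs_mor F (fs_prod factors) J.
Proof.
apply: fs_mor_intro => //.
- by move=> P Q phi x h; exact: (fs_maps fsF h).
- exact: fs_ext.
- exact: fs_id.
- exact: fs_comp.
move=> P Q phi h; have [sP sQ] := fs_obj fsF h.
have PS := sP.2; have QS := sQ.2.
have [psi0 [h0 e0]] := fs_mor_hom me h; have [psi1 [h1 e1]] := fs_mor_hom me' h.
pose psi (i : 'I_2) := if i == ord0 then psi0 else psi1.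
have psiJ x : P x -> prod_map psi (J x) = J (phi x).
  move=> Px; apply/ffunP => i; rewrite !ffunE /psi /prj.
  by case: ifP => _; [exact: e0 | exact: e1].
exists (prod_map psi); split=> //.
have subJ R : subgroup R S -> subgroup (J @` R) T.
  move=> [gR RS]; split; last by move=> _ [x /RS Sx <-]; exact: JT.
  by apply: is_group_image gR (morphicS RS _ morphicJ) => x /RS; exact: JT.
have prJ R i : @pr G 2 i @` (J @` R) = prj i @` R.
  by rewrite image_comp; apply: eq_imagel => x _ /=; rewrite /pr ffunE.
split; [exact: subJ|exact: subJ|exists psi; split=> //].
- move=> i /=; rewrite !prJ; split.
  + by move=> _ [x /PS Sx <-]; exact: prj_group.
  + by move=> _ [x /QS Sx <-]; exact: prj_group.
  + by rewrite /prj /psi; case: (i == ord0).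
- move=> _ [_ [x Px <-] <-]; rewrite psiJ //; exists (phi x) => //.
  exact: (fs_maps fsF h Px).
Qed.

(** The converse of the passage from a decomposition to its projections, used to
    contradict indecomposability. *)
Lemma splits_decomposition :
  direct_decomposition F (fun i => full F (split_group i)).
Proof.
split; first by move=> i; exact: full_subsystem (subgroup_split_group i).
exists I; split; last first.
  split; first exact: fs_mor_I; exists J; split; first exact: fs_mor_J.
    by move=> x /set_mem; exact: IK.
  by move=> x /set_mem; exact: JK.
split; first exact: fs_mor_I.
move=> i x /set_mem [Sx]; rewrite /I !ffunE.
  case: (i =P ord0) => [->|/eqP i0] /= k.
    by rewrite mulg1.
  by have -> : i = ord_max;
    [apply: val_inj; case: i i0 => [[|[|]]] | rewrite eqxx mul1g].
Qed.

End SplitDecomposition.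

Section IndecomposableSubsystem.
Variables (G : groupType) (F C : fusion_data G) (e e' : G -> G).
Hypotheses (fsF : fusion_system F) (sC : fusion_subsystem C F)
  (fullC : is_full F C) (sp : splits F e e').
Hypotheses (eC : forall x, fs_group C x -> fs_group C (e x))
  (e'C : forall x, fs_group C x -> fs_group C (e' x)).

(** The components and the extensions of a morphism of C have source and target
    in the group of C, and C is full. *)
Lemma splits_full : splits C e e'.
Proof.
have [fsC CF _] := sC.
have toF P phi : hom_on C P phi -> hom_on F P phi.
  by case/fullC => _ _; exact: hom_onW.
have toC P Q phi : hom_on F P phi -> Q `<=` P -> is_group Q ->
    Q `<=` fs_group C -> (forall x, Q x -> fs_group C (phi x)) ->
    hom_on C Q phi.
  move=> h QP gQ QC phiC; apply/fullC; split=> //.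
  apply: (fs_restrict fsF h) => //.
    by split=> // x /QC; exact: CF.
  by split=> //; exact: fs_is_group.
have me : fs_mor C C e by exact: (fs_mor_full fsF _ _ _ _ (split_end sp) eC).
have me' : fs_mor C C e'.
  by exact: (fs_mor_full fsF _ _ _ _ (split_endC sp) e'C).
have gC := fs_is_group fsC.
split=> //.
- by move=> x /CF; exact: (split_mul sp).
- by move=> x /CF; exact: (split_ann sp).
- by move=> x /CF; exact: (split_annC sp).
- move=> P phi h k l; apply: (toC _ _ _ (split_ext sp (toF _ _ h) k l)).
  + by move=> x [/CF].
  + exact: is_group_preimage gC me.1 (fs_dom fsC h).1.
  + by move=> x [].
  + move=> x [Cx Px]; apply: is_groupM => //; last exact: e'C.
    exact: (fs_maps fsC h Px).
- move=> P phi h k l; apply: (toC _ _ _ (split_extC sp (toF _ _ h) k l)).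
  + by move=> x [/CF].
  + exact: is_group_preimage gC me'.1 (fs_dom fsC h).1.
  + by move=> x [].
  + move=> x [Cx Px]; apply: is_groupM => //; last exact: eC.
    exact: (fs_maps fsC h Px).
Qed.

(** The two subgroups of elements fixed by e and by e' carry a decomposition of
    C, so one of them is the whole group. *)
Lemma indecomposable_absorbed : indecomposable C ->
  (forall x, fs_group C x -> e' x = 1) \/ (forall x, fs_group C x -> e x = 1).
Proof.
move=> indC; have [fsC _ _] := sC; have spC := splits_full.
apply: contrapT => /not_orP[n0 n1]; apply: indC.
exists (fun i => full C (split_group C e e' i)); split;
  last exact: splits_decomposition.
move=> i; split=> [x []//|/= sub].
case: (EM (i = ord0)) => i0.
  by apply: n0 => x /sub[_]; rewrite i0 eqxx.
by apply: n1 => x /sub[_]; case: eqP.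
Qed.

End IndecomposableSubsystem.

Section Coordinates.
Variables (G : groupType) (k : nat) (F : fusion_data G).
Variable E : 'I_k -> fusion_data G.
Local Notation S := (fs_group F).
Local Notation T := (fun i => fs_group (E i)).

(** The isomorphism from E_1 x ... x E_k to F and its inverse; J x i is the i-th
    component of x in S. *)
Record coordinates (I : {ffun 'I_k -> G} -> G) (J : G -> {ffun 'I_k -> G}) :
  Prop := Coordinates {
  coord_sub : forall i, fusion_subsystem (E i) F;
  coord_morI : fs_mor (fs_prod E) F I;
  coord_morJ : fs_mor F (fs_prod E) J;
  coord_IK : forall y, direct_prod T y -> J (I y) = y;
  coord_JK : forall x, S x -> I (J x) = x;
  coord_inj : forall i x, T i x -> I (Defs.factor_inj i x) = x }.

Lemma direct_decomposition_coordinates : direct_decomposition F E ->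
  exists I J, coordinates I J.
Proof.
move=> [sE [I [[mI inj] [_ [J [mJ IK JK]]]]]]; exists I, J; split=> //.
- by move=> y Ty; apply: IK; exact: mem_set.
- by move=> x Sx; apply: JK; exact: mem_set.
- by move=> i x Tx; apply: inj; exact: mem_set.
Qed.

Variables (I : {ffun 'I_k -> G} -> G) (J : G -> {ffun 'I_k -> G}).
Hypotheses (fsF : fusion_system F) (crd : coordinates I J).
Implicit Types (P : set G) (phi : G -> G).

Let proj i x := J x i.

Lemma factor_fs i : fusion_system (E i).
Proof. by case: (coord_sub crd i). Qed.

Lemma factor_group i : is_group (T i).
Proof. exact: fs_is_group (factor_fs i). Qed.

Lemma factor_sub i x : T i x -> S x.
Proof. by case: (coord_sub crd i) => _ + _; exact. Qed.

Lemma subgroup_factor i : subgroup (T i) S.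
Proof. by split; [exact: factor_group | exact: factor_sub]. Qed.

Lemma coord_in i x : S x -> T i (J x i).
Proof. by move=> Sx; have [[m _] _] := coord_morJ crd; exact: (m x Sx i). Qed.

Lemma coord_I (y : {ffun 'I_k -> G}) : (forall i, T i (y i)) -> S (I y).
Proof. by move=> Ty; have [[m _] _] := coord_morI crd; exact: m. Qed.

Lemma coordM i x y : S x -> S y -> J (x * y) i = J x i * J y i.
Proof.
move=> Sx Sy; have [m _] := coord_morJ crd.
by rewrite (morphicM m) // ffunE.
Qed.

Lemma coord_eq x y : S x -> S y -> (forall i, J x i = J y i) -> x = y.
Proof.
move=> Sx Sy e; rewrite -(coord_JK crd Sx) -(coord_JK crd Sy).
by congr (I _); apply/ffunP.
Qed.

Lemma coord_IE (y : 'I_k -> G) i : (forall i, T i (y i)) ->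
  J (I [ffun i => y i]) i = y i.
Proof. by move=> Ty; rewrite (coord_IK crd) ?ffunE // => j; rewrite ffunE. Qed.

Lemma coord_factor i j x : T i x -> J x j = if j == i then x else 1.
Proof.
move=> Tx; rewrite -{1}(coord_inj crd Tx) (coord_IK crd) ?ffunE // => l.
by rewrite ffunE; case: eqP => [->|_] //; exact: is_group1 (factor_group l).
Qed.

Lemma coord_factorE i x : T i x -> J x i = x.
Proof. by move=> Tx; rewrite (coord_factor _ Tx) eqxx. Qed.

Lemma factor_coord1P i x :
  S x -> (forall j, j != i -> J x j = 1) -> T i x.
Proof.
move=> Sx x1; suff -> : x = J x i by exact: coord_in.
have Tx := coord_in i Sx.
apply: coord_eq => //; first exact: factor_sub Tx.
move=> j; rewrite (coord_factor _ Tx).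
by case: eqP => [->|/eqP /x1].
Qed.

Lemma factors_disjoint i j x : T i x -> T j x -> i != j -> x = 1.
Proof.
move=> Ti Tj ij; rewrite -(coord_factorE Ti) (coord_factor _ Tj).
by rewrite (negbTE ij).
Qed.

Let morphic_coord i : morphic S (T i) (fun x => J x i).
Proof.
apply: morphicP => [x|x y Sx Sy]; [exact: coord_in | exact: coordM].
Qed.

(** Elements whose coordinates of index >= n are trivial lie in H, by induction
    on n: the coordinate of index n is split off on the right. *)
Lemma factors_generate H :
  is_group H -> (forall i, T i `<=` H) -> S `<=` H.
Proof.
move=> gH TH x Sx.
suff main n (y : {ffun 'I_k -> G}) : (forall i, T i (y i)) ->
    (forall i : 'I_k, n <= i -> y i = 1) -> H (I y).
  rewrite -(coord_JK crd Sx); apply: (main k) => [i|i].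
    exact: coord_in.
  by rewrite leqNgt ltn_ord.
elim: n y => [|n IHn] y Ty y1.
  suff -> : I y = 1 by exact: is_group1.
  have -> : y = 1 by apply/ffunP => i; rewrite ffunE y1.
  have gT : is_group (direct_prod T) by apply: is_group_direct_prod;
    exact: factor_group.
  by have [m _] := coord_morI crd; exact: morphic1 gT m.
have [kn|nk] := leqP k n.
  apply: IHn => // i ni; apply: y1.
  by have := leq_ltn_trans kn (leq_ltn_trans ni (ltn_ord i)); rewrite ltnn.
pose i0 := Ordinal nk.
pose y' : {ffun 'I_k -> G} := [ffun i => if i == i0 then 1 else y i].
have Ty' i : T i (y' i).
  by rewrite ffunE; case: eqP => _ //; exact: is_group1 (factor_group i).
have Ti i : T i (Defs.factor_inj i0 (y i0) i).
  by rewrite ffunE; case: eqP => [->|_] //; exact: is_group1 (factor_group i).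
have -> : y = y' * Defs.factor_inj i0 (y i0).
  apply/ffunP => i; rewrite !ffunE; case: eqP => [->|_];
    by rewrite ?mul1g ?mulg1.
have [m _] := coord_morI crd; rewrite (morphicM m) // (coord_inj crd) //.
apply: is_groupM => //; last exact: TH (Ty i0).
apply: IHn => // i ni; rewrite ffunE; case: eqP => // /eqP ii0; apply: y1.
by rewrite ltn_neqAle ni andbT eq_sym; apply: contra ii0 => /eqP e; apply/eqP;
  exact: val_inj.
Qed.

Lemma coord_hom P phi : hom_on F P phi -> exists phis : 'I_k -> G -> G,
  forall i, fs_hom (E i) (proj i @` P) (proj i @` S) (phis i) /\
            forall x, P x -> phis i (J x i) = J (phi x) i.
Proof.
move=> h; have [Psi [[sJP sJS [phis [hphis _ e]]] e']] :=
  fs_mor_hom (coord_morJ crd) h.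
exists phis => i; split.
  have prJ R : @pr G k i @` (J @` R) = proj i @` R.
    by rewrite image_comp; apply: eq_imagel.
  by have := hphis i; rewrite !prJ.
move=> x Px; rewrite -e' // e ?ffunE //.
by apply: mem_set; exists x.
Qed.

(** A morphism of F between subgroups of one factor equals its own component
    there, hence lies in that factor. *)
Lemma factor_full i : is_full F (E i).
Proof.
move=> P Q phi; have [fsE _ EF] := coord_sub crd i; split.
  by move=> h; have [[_ PT] [_ QT]] := fs_obj fsE h; split=> //; exact: EF.
move=> [PT QT h]; have [phis /(_ i)[hi ei]] := coord_hom (hom_onW fsF h).
have [sP sQ] := fs_obj fsF h.
apply: (fs_restrict fsE hi).
- by split=> //; exact: sP.1.
- by move=> x Px; exists x => //; exact: coord_factorE (PT _ Px).
- by split=> //; exact: sQ.1.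
- by move=> x Px; exact: (fs_maps fsF h Px).
- move=> x Px; have Tp := QT _ (fs_maps fsF h Px).
  by rewrite -[x in RHS](coord_factorE (PT _ Px)) ei // coord_factorE.
Qed.

(** A family of morphisms of F, each inside one factor, assembles to a
    morphism of the product and hence of F.  The sources R i may be larger
    than the projections of P. *)
Lemma coord_build P (R : 'I_k -> set G) (phis : 'I_k -> G -> G) :
  subgroup P S -> (forall i, hom_on F (R i) (phis i)) ->
  (forall i x, R i x -> T i (phis i x)) ->
  (forall i x, P x -> R i (J x i)) ->
  hom_on F P (fun x => I [ffun i => phis i (J x i)]).
Proof.
move=> [gP PS] hphis phisT PR.
have [mJ _] := coord_morJ crd.
have subJ Q : is_group Q -> Q `<=` S -> subgroup (J @` Q) (direct_prod T).
  move=> gQ QS; split; last by move=> _ [x /QS Sx <-] i; exact: coord_in.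
  by apply: is_group_image gQ (morphicS QS _ mJ) => x /QS Sx;
    exact: (mJ.1 x Sx).
have TJ x : P x -> forall i, T i (phis i (J x i)).
  by move=> Px i; apply: phisT; exact: PR.
have h : fs_hom (fs_prod E) (J @` P) (J @` S) (prod_map phis).
  split; [exact: subJ|by apply: subJ => //; exact: fs_is_group|exists phis;
    split=> //].
  - move=> i; apply/factor_full; split.
    + by move=> _ [_ [x /PS Sx <-] <-]; exact: coord_in.
    + by move=> _ [_ [x Sx <-] <-]; exact: coord_in.
    + apply: (fs_restrict fsF (hphis i)) => //.
      * split; last by move=> _ [_ [x /PS Sx <-] <-];
          apply: (factor_sub (i := i)); exact: coord_in.
        rewrite image_comp;
          apply: is_group_image gP (morphicS PS _ (morphic_coord i)).
        by move=> x /PS; exact: coord_in.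
      * by move=> _ [_ [x Px <-] <-]; exact: PR.
      * split; last by move=> _ [_ [x Sx <-] <-]; apply: (factor_sub (i := i));
          exact: coord_in.
        by rewrite image_comp;
          apply: is_group_image (fs_is_group fsF) (morphic_coord i).
      * move=> _ [_ [x Px <-] <-]; have Tx := TJ x Px i.
        exists (J (phis i (J x i))); last by rewrite /pr coord_factorE.
        by exists (phis i (J x i)) => //; exact: factor_sub Tx.
  - move=> _ [_ [x Px <-] <-]; exists (I (prod_map phis (J x))).
      by apply: coord_I => i; rewrite ffunE; exact: TJ.
    by rewrite (coord_IK crd) // => i; rewrite ffunE; exact: TJ.
have [Psi [hPsi ePsi]] := fs_mor_hom (coord_morI crd) h.
have IJ x : P x -> Psi x = I [ffun i => phis i (J x i)].
  move=> Px; rewrite -{1}(coord_JK crd (PS _ Px)) ePsi; last by exists x.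
  by [].
apply: (fs_restrict fsF hPsi) => //.
- by move=> x Px; exists (J x); [exists x | exact: (coord_JK crd (PS _ Px))].
- exact: subgroup_refl.
- by move=> x Px; apply: coord_I => i; rewrite ffunE; exact: TJ.
- by move=> x Px; rewrite IJ.
Qed.

Lemma subgroup_preimage P h :
  fs_mor F F h -> is_group P -> subgroup [set x | S x /\ P (h x)] S.
Proof.
move=> mh gP; split; last by move=> x [].
exact: is_group_preimage (fs_is_group fsF) mh.1 gP.
Qed.

(** The projection of S onto the product of all factors except the i-th. *)
Definition cocoord i x : G := I [ffun j => if j == i then 1 else J x j].

Lemma coord_cocoord i j x :
  S x -> J (cocoord i x) j = if j == i then 1 else J x j.
Proof.
move=> Sx; rewrite (coord_IE (y := fun j => if j == i then 1 else J x j)) //.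
by move=> l; case: eqP => _; [exact: is_group1 (factor_group l) |
  exact: coord_in].
Qed.

Lemma cocoord_in i x : S x -> S (cocoord i x).
Proof.
move=> Sx; apply: coord_I => j; rewrite ffunE; case: eqP => _.
  exact: is_group1 (factor_group j).
exact: coord_in.
Qed.

Lemma factor_kerP i x : S x -> T i x <-> cocoord i x = 1.
Proof.
have S1 := is_group1 (fs_is_group fsF).
have J1 j : J 1 j = 1 by exact: morphic1 (fs_is_group fsF) (morphic_coord j).
move=> Sx; split=> [Tx|e].
  apply: coord_eq => // [|j]; first exact: cocoord_in.
  rewrite coord_cocoord // J1; case: eqP => // /eqP ji.
  by rewrite (coord_factor _ Tx) (negbTE ji).
apply: factor_coord1P => // j ji.
by have := coord_cocoord i j Sx; rewrite e J1 (negbTE ji).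
Qed.

Let fs_mor_coord i : fs_mor F F (proj i).
Proof.
apply/(fs_morP fsF _ fsF); split.
  apply: morphicS (morphic_coord i) => // x Sx.
  by apply: (factor_sub (i := i)); exact: coord_in.
move=> P phi /coord_hom[phis /(_ i)[hi ei]]; exists (phis i); split=> //.
have [_ _ EF] := coord_sub crd i; exact: hom_onW (EF _ _ _ hi).
Qed.

Let coord_homF P phi : hom_on F P phi -> exists phis : 'I_k -> G -> G, forall i,
  [/\ hom_on F (proj i @` P) (phis i),
      forall x, (proj i @` P) x -> T i (phis i x) &
      forall x, P x -> phis i (J x i) = J (phi x) i].
Proof.
move=> h; have [phis hphis] := coord_hom h; exists phis => i.
have [hi ei] := hphis i; have [_ _ EF] := coord_sub crd i.
split=> //; first exact: hom_onW (EF _ _ _ hi).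
move=> _ [x Px <-]; rewrite ei //; apply: coord_in; exact: (fs_maps fsF h Px).
Qed.

Let fs_mor_cocoord i : fs_mor F F (cocoord i).
Proof.
have gS := fs_is_group fsF.
have m : morphic S S (cocoord i).
  apply: morphicP => [x|x y Sx Sy]; first exact: cocoord_in.
  have [Sx' Sy'] := (cocoord_in i Sx, cocoord_in i Sy).
  have Sxy : S (x * y) by exact: is_groupM.
  apply: coord_eq => [| |j]; [exact: cocoord_in|exact: is_groupM|].
  rewrite coordM // !coord_cocoord // coordM //.
  by case: eqP; rewrite ?mulg1.
apply/(fs_morP fsF _ fsF); split=> // P phi h; have [gP PS] := fs_dom fsF h.
have [phis hphis] := coord_homF h.
pose R j := if j == i then [set 1] else proj j @` P.
pose phis' j := if j == i then id else phis j.
exists (fun x => I [ffun j => phis' j (J x j)]); split.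
  apply: (coord_build (R := R)).
  - split; first by apply: is_group_image gP (morphicS PS _ m) => x /PS;
      exact: cocoord_in.
    by move=> _ [x /PS Sx <-]; exact: cocoord_in.
  - move=> j; rewrite /R /phis'; case: ifP => _; last by case: (hphis j).
    apply: (fs_inclusion fsF); [|exact: subgroup_refl|].
      by split; [exact: is_group_trivial | move=> _ ->; exact: is_group1].
    by move=> _ ->; exact: is_group1.
  - move=> j x; rewrite /R /phis'; case: ifP => _.
      by move=> ->; exact: is_group1 (factor_group j).
    by case: (hphis j) => _ + _; exact.
  - move=> j _ [x Px <-]; rewrite /R coord_cocoord //; last exact: PS.
    by case: ifP => // _; exists x.
move=> x Px; have Sx := PS _ Px; congr (I _); apply/ffunP => j; rewrite !ffunE.
rewrite coord_cocoord // /phis'; case: ifP => // _.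
by case: (hphis j) => _ _; exact.
Qed.

(** The decomposition of F into E_i and the product of the other factors. *)
Lemma coordinate_splits i : splits F (proj i) (cocoord i).
Proof.
have gS := fs_is_group fsF.
have pS x : S x -> S (J x i) by move=> Sx; apply: (factor_sub (i := i));
  exact: coord_in.
have TF j : hom_on F (T j) id.
  apply: (fs_inclusion fsF); [exact: subgroup_factor|exact: subgroup_refl|].
  by move=> x; exact: factor_sub.
split=> //.
- move=> x Sx; have Sx' := cocoord_in i Sx; have Sp := pS x Sx.
  apply: coord_eq => // [|j]; first exact: is_groupM.
  rewrite coordM // coord_cocoord // (coord_factor _ (coord_in i Sx)).
  by case: eqP => [->|_]; rewrite ?mulg1 ?mul1g.
- by move=> x Sx; apply/factor_kerP; [exact: pS | exact: coord_in].
- by move=> x Sx; rewrite /proj coord_cocoord // eqxx.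
- move=> P phi h k1 k2; have [gP PS] := fs_dom fsF h.
  have PT x : P x -> T i x by move=> Px; apply/factor_kerP;
    [exact: PS | exact: k1].
  have pT x : P x -> T i (phi x).
    by move=> Px; apply/factor_kerP; [exact: (fs_maps fsF h Px) | exact: k2].
  pose R j := if j == i then P else T j.
  pose phis j := if j == i then phi else id.
  have hb : hom_on F [set x | S x /\ P (J x i)]
      (fun x => I [ffun j => phis j (J x j)]).
    apply: (coord_build (R := R)).
    + exact: subgroup_preimage (fs_mor_coord i) gP.
    + by move=> j; rewrite /R /phis; case: ifP.
    + by move=> j x; rewrite /R /phis; case: eqP => // ->; exact: pT.
    + by move=> j x [Sx Px]; rewrite /R; case: eqP => [->|_] //;
        exact: coord_in.
  apply: (fs_ext fsF) hb => x /set_mem[Sx Px].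
  have Tp j : T j (phis j (J x j)).
    by rewrite /phis; case: eqP => [->|_]; [exact: pT | exact: coord_in].
  have [Sp Sx'] := (factor_sub (pT _ Px), cocoord_in i Sx).
  apply: coord_eq => [| |j]; [by apply: coord_I => j;
    rewrite ffunE|exact: is_groupM|].
  rewrite (coord_IE (y := fun j => phis j (J x j))) // coordM //.
  rewrite coord_cocoord // (coord_factor _ (pT _ Px)) /phis.
  by case: eqP => [->|_]; rewrite ?mulg1 ?mul1g.
- move=> P phi h k1 k2; have [gP PS] := fs_dom fsF h.
  have [phis hphis] := coord_homF h.
  pose R j := if j == i then T j else proj j @` P.
  pose phis' j := if j == i then id else phis j.
  have hb : hom_on F [set x | S x /\ P (cocoord i x)]
      (fun x => I [ffun j => phis' j (J x j)]).
    apply: (coord_build (R := R)).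
    + exact: subgroup_preimage (fs_mor_cocoord i) gP.
    + by move=> j; rewrite /R /phis'; case: ifP => _ //; case: (hphis j).
    + move=> j x; rewrite /R /phis'; case: ifP => _ //.
      by case: (hphis j) => _ + _; exact.
    + move=> j x [Sx Px]; rewrite /R; case: ifP => ji; first exact: coord_in.
      by exists (cocoord i x) => //; rewrite /proj coord_cocoord // ji.
  apply: (fs_ext fsF) hb => x /set_mem[Sx Px].
  have Sp : S (phi (cocoord i x)) by exact: (fs_maps fsF h Px).
  have vE j : phis' j (J x j) =
      if j == i then J x j else J (phi (cocoord i x)) j.
    rewrite /phis'; case: ifP => // ji; have [_ _ <- //] := hphis j.
    by rewrite coord_cocoord // ji.
  have Tp j : T j (phis' j (J x j)) by rewrite vE; case: ifP => _;
    exact: coord_in.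
  apply: coord_eq => [| |j]; [by apply: coord_I => j;
    rewrite ffunE|by apply: is_groupM => //; exact: pS|].
  rewrite (coord_IE (y := fun j => phis' j (J x j))) // coordM //;
    last exact: pS.
  rewrite vE (coord_factor _ (coord_in i Sx)).
  case: eqP => [->|_]; rewrite ?mulg1 //.
  by have := k2 _ Px; rewrite /proj => ->; rewrite mul1g.
Qed.

End Coordinates.

(** * Automorphisms permute the indecomposable factors *)

Section ConjugateSplitting.
Variables (G : groupType) (F : fusion_data G) (a b : G -> G).
Hypotheses (fsF : fusion_system F) (ma : fs_mor F F a) (mb : fs_mor F F b).
Local Notation S := (fs_group F).
Hypotheses (aK : forall x, S x -> b (a x) = x)
  (bK : forall x, S x -> a (b x) = x).

Let conj (e : G -> G) x := b (e (a x)).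

Let fs_mor_conj e : fs_mor F F e -> fs_mor F F (conj e).
Proof.
move=> me; have mea := fs_mor_comp fsF fsF fsF ma me; exact: fs_mor_comp mea mb.
Qed.

Let conj_ext e e' P phi : splits F e e' -> hom_on F P phi ->
  (forall x, P x -> conj e' x = 1) -> (forall x, P x -> conj e' (phi x) = 1) ->
  hom_on F [set x | S x /\ P (conj e x)] (fun x => phi (conj e x) * conj e' x).
Proof.
move=> sp h k l; have gS := fs_is_group fsF; have [gP PS] := fs_dom fsF h.
have [me me'] := (split_end sp, split_endC sp).
have conj1 x : S x -> conj e' x = 1 -> e' (a x) = 1.
  move=> Sx e1; have Sax := end_map ma Sx.
  by rewrite -(bK (end_map me' Sax)) (e1 : b _ = 1) (end1 fsF ma).
have phiS x : P x -> S (phi x) by exact: (fs_maps fsF h).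
have [psi [hpsi epsi]] := end_hom fsF ma h.
have hs : hom_on F [set x | S x /\ (a @` P) (e x)] (fun x => psi (e x) * e' x).
  apply: (split_ext sp hpsi) => _ [x Px <-]; last rewrite epsi //.
    by apply: conj1; [exact: PS | exact: k].
  by apply: conj1; [exact: phiS | exact: l].
have [chi [hchi echi]] := end_hom fsF mb hs.
apply: (fs_restrict fsF hchi).
- split; last by move=> x [].
  exact: is_group_preimage gS (fs_mor_conj me).1 gP.
- move=> x [Sx Px]; have Sax := end_map ma Sx.
  exists (a x); last exact: aK.
  by split=> //; exists (conj e x) => //; rewrite /conj bK //; exact: end_map.
- exact: subgroup_refl.
- move=> x [Sx Px]; apply: is_groupM => //; first exact: phiS.
  exact: end_map (fs_mor_conj me') Sx.
move=> x [Sx Px]; have Sax := end_map ma Sx; have Seax := end_map me Sax.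
have eax : e (a x) = a (conj e x) by rewrite /conj bK.
have aP : (a @` P) (e (a x)) by rewrite eax; exists (conj e x).
have Sp := phiS _ Px.
rewrite -{3}(aK Sx) echi //; first rewrite eax epsi // (endM mb) ?aK //.
- exact: end_map.
- exact: end_map.
Qed.

(** This is the image of the decomposition under the automorphism b of F. *)
Lemma splits_conj e e' : splits F e e' ->
  splits F (fun x => b (e (a x))) (fun x => b (e' (a x))).
Proof.
move=> sp; have [me me'] := (split_end sp, split_endC sp).
have aS x : S x -> S (a x) by exact: end_map.
split; [exact: fs_mor_conj|exact: fs_mor_conj| | | | |].
- move=> x Sx; rewrite -(endM mb); try by apply: end_map => //; exact: aS.
  by rewrite (split_mul sp) ?aK //; exact: aS.
- move=> x Sx; have Sax := aS _ Sx.
  by rewrite bK ?(split_ann sp) ?(end1 fsF mb) //; exact: end_map.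
- move=> x Sx; have Sax := aS _ Sx.
  by rewrite bK ?(split_annC sp) ?(end1 fsF mb) //; exact: end_map.
- by move=> P phi; exact: conj_ext sp.
- by move=> P phi; exact: conj_ext (splits_sym fsF sp).
Qed.

End ConjugateSplitting.

Lemma Aut_fs_mor (G : groupType) (F : fusion_data G) (a : sym G) :
  Aut_fs F a -> fs_mor F F a.
Proof. by case=> _ []. Qed.

Section PermuteFactors.
Variables (G : groupType) (k : nat) (F : fusion_data G).
Variable E : 'I_k -> fusion_data G.
Local Notation S := (fs_group F).
Local Notation T := (fun i => fs_group (E i)).
Variables (I : {ffun 'I_k -> G} -> G) (J : G -> {ffun 'I_k -> G}).
Hypotheses (fsF : fusion_system F) (crd : coordinates F E I J).
Hypothesis hF : fs_center F = [set 1] \/ focal F = fs_group F.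
Hypothesis indE : forall i, indecomposable (E i).

(** The projections for the factor i, conjugated by a, are compared with those
    for the indecomposable factor j. *)
Lemma Aut_factor_dichotomy a i j : Aut_fs F a ->
  (forall x, T j x -> T i (a x)) \/ (forall x, T j x -> J (a x) i = 1).
Proof.
move=> Aa; have ma := Aut_fs_mor Aa; have mb := Aut_fs_mor (Aut_fs_inv fsF Aa).
have aK x : S x -> (a^-1)%g (a x) = x by move=> _; exact: symVKV.
have bK x : S x -> a ((a^-1)%g x) = x by move=> _; exact: symKV.
have spi := coordinate_splits fsF crd i;
  have spj := coordinate_splits fsF crd j.
have spa := splits_conj fsF ma mb aK bK spi.
have aS x : S x -> S (a x) by exact: end_map.
have TS x : T j x -> S x by exact: (factor_sub crd).
have inT e e' x : splits F e e' -> T j x -> T j (e x).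
  move=> sp Tx; have Sx := TS _ Tx; have Sex := end_map (split_end sp) Sx.
  apply/(factor_kerP fsF crd) => //.
  rewrite -{1}(coord_factorE crd Tx).
  exact: (cross_projection_trivial fsF hF sp spj Sx).
have fullj := factor_full fsF crd j.
have a1 : a 1 = 1 by exact: (end1 fsF ma).
have [||h|h] :=
  indecomposable_absorbed fsF (coord_sub crd j) fullj spa _ _ (@indE j).
- by move=> x; exact: inT spa.
- by move=> x; exact: inT (splits_sym fsF spa).
- left=> x Tx; apply/(factor_kerP fsF crd); first exact: aS (TS _ Tx).
  by rewrite -(symKV a (cocoord _ _ _ _)) h.
- by right=> x Tx; rewrite -(symKV a (J _ _)) h.
Qed.

(** Otherwise all coordinates of a(T j) would be trivial. *)
Lemma Aut_factor_sub a j : Aut_fs F a -> T j <> [set 1] ->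
  exists i, forall x, T j x -> T i (a x).
Proof.
move=> Aa nT; apply: contrapT => /forallNP n; apply: nT; apply/seteqP; split.
  move=> x Tx; have Sx := factor_sub crd Tx.
  have Sax := Aut_fs_map Aa Sx; have S1 := is_group1 (fs_is_group fsF).
  have a1 := end1 fsF (Aut_fs_mor Aa).
  suff ax1 : a x = 1 by rewrite /= -(symVKV a x) ax1 -a1 symVKV.
  apply: (coord_eq crd) => // i.
  have [//|->//] := Aut_factor_dichotomy i j Aa; first by move/(n i).
  by have [m _] := coord_morJ crd; rewrite (morphic1 (fs_is_group fsF) m) ffunE.
by move=> _ ->; exact: is_group1 (factor_group crd j).
Qed.

(** The image of T j lies in some T i whose image under the inverse lies in some
    T l; since T l meets T j nontrivially, l = j and both inclusions are
    equalities. *)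
Lemma Aut_factor_image a j : Aut_fs F a -> exists i, a @` T j = T i.
Proof.
move=> Aa; have Aa' := Aut_fs_inv fsF Aa.
have a1 := end1 fsF (Aut_fs_mor Aa).
have [T1|nT] := EM (T j = [set 1]).
  by exists j; rewrite T1 image_set1 a1.
have [i ji] := Aut_factor_sub Aa nT.
have [x [Tx x1]] : exists x, T j x /\ x <> 1.
  apply: contrapT => /forallNP n; apply: nT; apply/seteqP; split.
    by move=> x Tx; apply: contrapT => x1; apply: (n x).
  by move=> _ ->; exact: is_group1 (factor_group crd j).
have nTi : T i <> [set 1].
  move=> T1; apply: x1; have : T i (a x) by exact: ji.
  by rewrite T1 => ax1; rewrite -(symVKV a x) (ax1 : a x = 1) -{1}a1 symVKV.
have [l il] := Aut_factor_sub Aa' nTi.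
have lj : l = j.
  apply/eqP; apply: contrapT => /negP n; apply: x1.
  apply: (factors_disjoint crd _ Tx n); rewrite -(symVKV a x).
  by apply: il; exact: ji.
rewrite {}lj in il; exists i; apply/seteqP; split.
  by move=> _ [y Ty <-]; exact: ji.
by move=> y Ty; exists ((a^-1)%g y); [exact: il | exact: symKV].
Qed.

End PermuteFactors.

(** * Gluing isomorphisms between the factors *)

Section Glue.
Variables (G : groupType) (k : nat) (F : fusion_data G).
Variable E : 'I_k -> fusion_data G.
Local Notation S := (fs_group F).
Local Notation T := (fun i => fs_group (E i)).
Variables (I : {ffun 'I_k -> G} -> G) (J : G -> {ffun 'I_k -> G}).
Hypotheses (fsF : fusion_system F) (crd : coordinates F E I J).
Implicit Types (s t : 'I_k -> 'I_k) (g : 'I_k -> G -> G).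

(** Acts as g i from the i-th factor to the factor of index s i, where t is the
    inverse of s. *)
Definition glue t g x : G := I [ffun j => g (t j) (J x (t j))].

Let glue_in s t g j x : cancel t s ->
  (forall i, fs_mor (E i) (E (s i)) (g i)) -> S x -> T j (g (t j) (J x (t j))).
Proof.
move=> tK mg Sx; have [[m _] _] := mg (t j).
by rewrite -{1}(tK j); apply: m; exact: coord_in crd _ _ Sx.
Qed.

Lemma coord_glue s t g j x : cancel t s ->
  (forall i, fs_mor (E i) (E (s i)) (g i)) -> S x ->
  J (glue t g x) j = g (t j) (J x (t j)).
Proof.
move=> tK mg Sx; rewrite (coord_IE crd (y := fun j => g (t j) (J x (t j)))) //.
by move=> l; exact: glue_in tK mg Sx.
Qed.

Lemma fs_mor_glue s t g : cancel t s ->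
  (forall i, fs_mor (E i) (E (s i)) (g i)) -> fs_mor F F (glue t g).
Proof.
move=> tK mg; have gS := fs_is_group fsF.
have glueS x : S x -> S (glue t g x).
  by move=> Sx; apply: (coord_I crd) => j; rewrite ffunE;
    exact: glue_in tK mg Sx.
have m : morphic S S (glue t g).
  apply: morphicP => // x y Sx Sy; have [Gx Gy] := (glueS _ Sx, glueS _ Sy).
  have Sxy : S (x * y) by exact: is_groupM.
  apply: (coord_eq crd) => [||j]; [exact: glueS|exact: is_groupM|].
  rewrite (coordM crd) // !(coord_glue _ tK mg) // (coordM crd) //.
  by have [mj _] := mg (t j); rewrite (morphicM mj) //; exact: (coord_in crd).
apply/(fs_morP fsF _ fsF); split=> // P phi h; have [gP PS] := fs_dom fsF h.
have [phis hphis] := coord_hom crd h.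
have /choice[psi hpsi] i : exists psi : G -> G,
    [/\ hom_on F (g i @` ((fun x => J x i) @` P)) psi,
        forall x, (g i @` ((fun x => J x i) @` P)) x -> T (s i) (psi x) &
        forall x, P x -> psi (g i (J x i)) = g i (J (phi x) i)].
  have [hi ei] := hphis i; have [psi [hp ep]] := fs_mor_hom (mg i) hi.
  have [fsE _ EF] := coord_sub crd (s i); exists psi; split.
  - exact: (hom_onW fsF (EF _ _ _ hp)).
  - by move=> x Px; apply: (fs_cod fsE hp).2; exact: (fs_maps fsE hp Px).
  - by move=> x Px; rewrite ep ?ei //; exists x.
exists (fun x => I [ffun j => psi (t j) (J x j)]); split.
  have mP : morphic P S (glue t g).
    by apply: (morphicS PS _ m) => x /PS; exact: glueS.
  apply: (coord_build fsF crd (phis := fun j => psi (t j))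
    (R := fun j => g (t j) @` ((fun x => J x (t j)) @` P))).
  - split; first exact: is_group_image gP mP.
    by move=> _ [x /PS Sx <-]; exact: glueS.
  - by move=> j; case: (hpsi (t j)).
  - by move=> j x; case: (hpsi (t j)) => _ + _ => /[apply]; rewrite tK.
  - move=> j _ [x Px <-]; rewrite (coord_glue _ tK mg); last exact: PS.
    by exists (J x (t j)) => //; exists x.
move=> x Px; congr (I _); apply/ffunP => j; rewrite !ffunE.
rewrite (coord_glue _ tK mg); last exact: PS.
by case: (hpsi (t j)) => _ _; exact.
Qed.

Lemma glue_Aut (s : 'S_k) g :
  (forall i, fs_isomorphism (E i) (E (s i)) (g i)) ->
  exists a, Aut_fs F a /\ forall i x, T i x -> a x = g i x.
Proof.
move=> isog; pose t := (s^-1)%g : 'S_k.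
have sK : cancel s t by exact: permK.
have tK : cancel t s by exact: permKV.
have mg i : fs_mor (E i) (E (s i)) (g i) by case: (isog i).
have /choice[h hh] i : exists h, [/\ fs_mor (E (s i)) (E i) h,
    {in T i, cancel (g i) h} & {in T (s i), cancel h (g i)}].
  by case: (isog i).
have mh j : fs_mor (E j) (E (t j)) (h (t j)).
  by have [] := hh (t j); rewrite tK.
have iso : fs_isomorphism F F (glue t g).
  split; first exact: fs_mor_glue tK mg.
  have mgl := fs_mor_glue tK mg; have mgl' := fs_mor_glue sK mh.
  exists (glue s (fun j => h (t j))); split=> // x /set_mem Sx.
    apply: (coord_eq crd) => // [|i].
      by apply: end_map mgl' _; exact: (end_map mgl Sx).
    rewrite (coord_glue _ sK mh); last exact: (end_map mgl Sx).
    rewrite (coord_glue _ tK mg) // !sK; case: (hh i) => _ + _; apply.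
    by apply: mem_set; exact: (coord_in crd).
  apply: (coord_eq crd) => // [|j].
    by apply: end_map mgl _; exact: (end_map mgl' Sx).
  rewrite (coord_glue _ tK mg); last exact: (end_map mgl' Sx).
  rewrite (coord_glue _ sK mh) // !sK !tK; case: (hh (t j)) => _ _; apply.
  by rewrite tK; apply: mem_set; exact: (coord_in crd).
have [a [Aa ea]] := Aut_fs_extend fsF iso; exists a; split=> // i x Tx.
have Sx := factor_sub crd Tx; have mgl := fs_mor_glue tK mg.
have Tgx : T (s i) (g i x) by have [[m _] _] := mg i; exact: m.
rewrite ea //; apply: (coord_eq crd) => [||j].
- exact: (end_map mgl Sx).
- exact: (factor_sub crd Tgx).
rewrite (coord_glue _ tK mg) //
  (coord_factor crd _ Tx) (coord_factor crd _ Tgx).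
have [->|ji] := eqVneq j (s i); first by rewrite sK eqxx.
rewrite ifN; last by apply: contra ji => /eqP <-; rewrite tK.
by have [m _] := mg (t j); exact: morphic1 (factor_group crd _) m.
Qed.

Lemma Aut_fs_eq_factors a b : Aut_fs F a -> Aut_fs F b ->
  (forall i x, T i x -> a x = b x) -> a = b.
Proof.
move=> Aa Ab e; apply: (Aut_fs_eq Aa Ab) => x Sx.
have [ma _] := Aut_fs_mor Aa; have [mb _] := Aut_fs_mor Ab.
have gH := is_group_equalizer (fs_is_group fsF) ma mb.
have [] // := factors_generate crd gH _ Sx.
by move=> i y Ty; split; [exact: (factor_sub crd Ty) | exact: (e i y Ty)].
Qed.

End Glue.

(** * Isomorphism classes of the factors *)

Lemma fs_isog_refl (G : groupType) (F : fusion_data G) :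
  fusion_system F -> fs_isog F F.
Proof. by exists id; exact: fs_isomorphism_refl. Qed.

Lemma fs_isog_sym (G H : groupType) (E : fusion_data G) (F : fusion_data H) :
  fs_isog E F -> fs_isog F E.
Proof. by move=> [f [mf [g [mg fK gK]]]]; exists g; split=> //; exists f. Qed.

Lemma fs_isog_trans (G H K : groupType) (D : fusion_data G)
    (E : fusion_data H) (F : fusion_data K) :
  fusion_system D -> fusion_system E -> fusion_system F ->
  fs_isog D E -> fs_isog E F -> fs_isog D F.
Proof.
move=> fsD fsE fsF [f hf] [g hg]; exists (g \o f).
exact: fs_isomorphism_comp hf hg.
Qed.

Lemma is_group_iso_perms (G : groupType) k (E : 'I_k -> fusion_data G) :
  (forall i, fusion_system (E i)) -> is_group (iso_perms E).
Proof.
move=> fsE; split=> [i|s t es et i]; first by rewrite perm1;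
  exact: fs_isog_refl.
rewrite permM; apply: fs_isog_trans (es i) => //.
by have := et ((t^-1)%g (s i)); rewrite permKV; exact: fs_isog_sym.
Qed.

(** Every factor is identified with the representative E (r i) of its
    isomorphism class.  Going through the representative makes the resulting
    isomorphisms between factors of one class compatible with composition. *)
Lemma iso_class_charts (G : groupType) k (E : 'I_k -> fusion_data G) :
  (forall i, fusion_system (E i)) ->
  exists (r : 'I_k -> 'I_k) (c d : 'I_k -> G -> G),
    (forall i j, fs_isog (E i) (E j) -> r i = r j) /\
    (forall i, [/\ fs_isomorphism (E (r i)) (E i) (c i),
       fs_isomorphism (E i) (E (r i)) (d i),
       (forall x, fs_group (E (r i)) x -> d i (c i x) = x) &
       (forall x, fs_group (E i) x -> c i (d i x) = x)]).
Proof.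
move=> fsE.
pose cls i j := `[< fs_isog (E j) (E i) >].
pose r i := odflt i [pick j | cls i j].
have rP i : fs_isog (E (r i)) (E i).
  rewrite /r; case: pickP => [j /asboolP //|/(_ i)/negbT/asboolP[]].
  exact: fs_isog_refl.
have /choice[cd cdP] i : exists cd : (G -> G) * (G -> G),
    [/\ fs_isomorphism (E (r i)) (E i) cd.1,
       fs_isomorphism (E i) (E (r i)) cd.2,
       (forall x, fs_group (E (r i)) x -> cd.2 (cd.1 x) = x) &
       (forall x, fs_group (E i) x -> cd.1 (cd.2 x) = x)].
  have [c [mc [d [md cK dK]]]] := rP i; exists (c, d) => /=; split.
  - by split=> //; exists d.
  - by split=> //; exists c.
  - by move=> x Tx; apply: cK; exact: mem_set.
  - by move=> x Tx; apply: dK; exact: mem_set.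
exists r, (fun i => (cd i).1), (fun i => (cd i).2); split=> // i j ij.
rewrite /r; have e : cls i =1 cls j.
  move=> l; apply/asboolP/asboolP => h.
    exact: (fs_isog_trans (fsE l) (fsE i) (fsE j) h ij).
  exact: (fs_isog_trans (fsE l) (fsE j) (fsE i) h (fs_isog_sym ij)).
rewrite -(eq_pick e); case: pickP => //= /(_ i)/negbT/asboolP[].
exact: fs_isog_refl.
Qed.

(** * Isomorphisms of subgroups and quotients *)

Lemma isog_trans (G H K : magmaType) (A : set G) (B : set H) (C : set K) :
  isog A B -> isog B C -> isog A C.
Proof.
move=> [f [[fAB fM] [_ fI fS]]] [g [[gBC gM] [_ gI gS]]]; exists (g \o f).
have fB x : A x -> B (f x) by exact: fAB.
split; [split=> [x Ax|x y Ax Ay /=]|split].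
- by apply: gBC; exact: fB.
- have [Ax' Ay'] := (set_mem Ax, set_mem Ay).
  by rewrite fM // gM //; apply: mem_set; exact: fB.
- by move=> x Ax; apply: gBC; exact: fB.
- move=> x y Ax Ay e; apply: fI => //.
  by apply: gI => //; apply: mem_set; apply: fB; exact: set_mem.
- by move=> z /gS[y /fS[x Ax <-] <-]; exists x.
Qed.

(** The point x0 only serves as the value of the inverse off B. *)
Lemma isog_sym (G H : magmaType) (A : set G) (B : set H) (x0 : G) :
  (forall x y, A x -> A y -> A (x * y)) -> isog A B -> isog B A.
Proof.
move=> AM [f [[fAB fM] [_ fI fS]]].
have /choice[g gP] z : exists x, B z -> A x /\ f x = z.
  by have [/fS[x Ax e]|] := EM (B z); [exists x | exists x0].
have gA z : B z -> A (g z) by move=> /gP[].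
have fg z : B z -> f (g z) = z by move=> /gP[].
have fB x : A x -> B (f x) by exact: fAB.
exists g; split; [split=> // y z /set_mem By /set_mem Bz|split=> //].
- have [Ay Az] := (gA _ By, gA _ Bz).
  have fyz : f (g y * g z) = y * z by rewrite fM ?fg //; exact: mem_set.
  apply: fI; [| |rewrite fyz fg // -fyz].
  + by apply: mem_set; apply: gA; rewrite -fyz; apply: fB; exact: AM.
  + by apply: mem_set; exact: AM.
  + by apply: fB; exact: AM.
- by move=> y z /set_mem By /set_mem Bz e; rewrite -(fg _ By) e fg.
- move=> x Ax; exists (f x); first exact: fB.
  have Bfx := fB _ Ax; apply: fI; [|exact: mem_set|exact: fg].
  by apply: mem_set; exact: gA.
Qed.

(** Each coset of the normal factor meets the complement in one element. *)
Lemma semidirect_quotient (G : groupType) (A N K : set G) :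
  is_group A -> semidirect A N K -> isog K (cosets A N).
Proof.
move=> gA [[[gN NA] nN] [gK KA] NK1 NKA].
pose cs x : set G := [set x * n | n in N].
have cN g x : A g -> N x -> N (g^-1 * x * g).
  by move=> Ag Nx; have := nN g^-1 x (is_groupV gA Ag) Nx; rewrite /cnj invgK.
have cs_sub x n : N n -> cs (x * n) `<=` cs x.
  by move=> Nn _ [m Nm <-]; exists (n * m); [exact: is_groupM | rewrite mulgA].
have cs_eq x n : N n -> cs (x * n) = cs x.
  move=> Nn; apply/seteqP; split; first exact: cs_sub.
  rewrite -{1}(mulgK n x); apply: cs_sub; exact: is_groupV.
exists cs; split; [split|split].
- by move=> x /KA Ax; exists x.
- move=> x y /set_mem /KA Ax /set_mem /KA Ay; apply/seteqP; split.
    move=> _ [n Nn <-]; exists x; first by exists 1;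
      [exact: is_group1 | rewrite mulg1].
    by exists (y * n); [exists n | rewrite mulgA].
  move=> _ [_ [n Nn <-] [_ [m Nm <-] <-]]; exists (y^-1 * n * y * m).
    by apply: is_groupM => //; exact: cN.
  by rewrite -!mulgA !mulVKg.
- by move=> x /KA Ax; exists x.
- move=> x y /set_mem Kx /set_mem Ky e.
  have : cs y x by rewrite -e; exists 1; [exact: is_group1 | rewrite mulg1].
  move=> [n Nn nx]; suff -> : y = x by [].
  have : (N `&` K) n.
    split=> //; have -> : n = y^-1 * x by rewrite -nx mulKg.
    by apply: is_groupM => //; exact: is_groupV.
  by rewrite NK1 -nx => ->; rewrite mulg1.
- move=> _ [g Ag <-]; move: (Ag); rewrite -NKA => -[n Nn [x Kx e]].
  exists x => //; rewrite -/(cs g) -e.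
  have -> : n * x = x * (x^-1 * n * x) by rewrite !mulgA mulgV mul1g.
  by rewrite cs_eq //; apply: cN => //; exact: KA.
Qed.

(** * The structure of the automorphism group *)

Lemma sym_imageM (U : Type) (a b : sym U) (A : set U) :
  (a * b)%g @` A = a @` (b @` A).
Proof. by rewrite image_comp. Qed.

Lemma sym_imageV (U : Type) (a : sym U) (A B : set U) :
  a @` A = B -> (a^-1)%g @` B = A.
Proof.
move=> <-; rewrite -sym_imageM mulVg.
by apply/seteqP; split=> [_ [x Ax <-]|x Ax] //; exists x.
Qed.

Section AutomorphismGroup.
Variables (G : groupType) (k : nat) (F : fusion_data G).
Variable E : 'I_k -> fusion_data G.
Local Notation S := (fs_group F).
Local Notation T := (fun i => fs_group (E i)).
Variables (I : {ffun 'I_k -> G} -> G) (J : G -> {ffun 'I_k -> G}).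
Hypotheses (fsF : fusion_system F) (crd : coordinates F E I J).

Let fsE i : fusion_system (E i) := factor_fs crd i.
Let gAut : is_group (Aut_fs F) := is_group_Aut_fs fsF.

(** The factors are full subsystems of F, so an isomorphism of F needs to match
    only their groups. *)
Lemma Aut_restrict a i j : Aut_fs F a -> a @` T i = T j ->
  fs_isomorphism (E i) (E j) a.
Proof.
move=> Aa e;
  apply: (fs_isomorphism_full fsF) (coord_sub crd i) _ (coord_sub crd j)
  _ (Aut_fs_mor Aa) (Aut_fs_mor (Aut_fs_inv fsF Aa)) _ _ e.
- exact: (factor_full fsF crd).
- exact: (factor_full fsF crd).
- by move=> x _; exact: symVKV.
- by move=> x _; exact: symKV.
Qed.

Lemma is_group_Aut0 : is_group (Aut0_fs F E).
Proof.
split=> [|a b [Aa a0] [Ab b0]].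
  split=> [|i]; first exact: is_group1.
  by apply/seteqP; split=> [_ [x Tx <-]|x Tx] //; exists x.
split=> [|i]; first exact: gAut.2.
by rewrite sym_imageM (sym_imageV (b0 i)).
Qed.

(** Restriction to the factors is injective because they generate S, and
    surjective because automorphisms of the factors glue. *)
Lemma Aut0_isog : isog (Aut0_fs F E) (direct_prod (fun i => Aut_fs (E i))).
Proof.
have /choice[res resP] (a : sym G) : exists b : {ffun 'I_k -> sym G},
    Aut0_fs F E a -> forall i, Aut_fs (E i) (b i) /\ forall x, T i x ->
      b i x = a x.
  have [[Aa a0]|n] := EM (Aut0_fs F E a); last by exists [ffun=> a].
  have /choice[b bP] i : exists b, Aut_fs (E i) b /\ forall x, T i x ->
    b x = a x.
    exact: Aut_fs_extend (fsE i) (Aut_restrict Aa (a0 i)).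
  by exists [ffun i => b i] => _ i; rewrite ffunE.
have resA a i : Aut0_fs F E a -> Aut_fs (E i) (res a i) by move=> /resP/(_ i)[].
have resE a i x : Aut0_fs F E a -> T i x -> res a i x = a x.
  by move=> /resP/(_ i)[_]; exact.
exists res; split; [split|split].
- by move=> a Aa i; exact: resA.
- move=> a b /set_mem Aa /set_mem Ab; have Aab := is_groupM is_group_Aut0 Aa Ab.
  apply/ffunP => i; rewrite ffunE.
  apply: (Aut_fs_eq (F := E i)) => [||x Tx].
  + exact: resA.
  + by apply: is_groupM (is_group_Aut_fs (fsE i)) _ _; exact: resA.
  + rewrite resE // !sym_mulE resE //; last exact: Aut_fs_map (resA _ _ Ab) Tx.
    by rewrite resE.
- by move=> a Aa i; exact: resA.
- move=> a b /set_mem Aa /set_mem Ab e.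
  apply: (Aut_fs_eq_factors fsF crd Aa.1 Ab.1) => i x Tx.
  by rewrite -(resE _ _ _ Aa Tx) e resE.
move=> b Ab; have bAut i : Aut_fs (E i) (b i) by exact: Ab.
have [|a [Aa ea]] := glue_Aut fsF crd (s := 1%g) (g := fun i => b i).
  by move=> i; rewrite perm1; have [] := bAut i.
have A0 : Aut0_fs F E a.
  split=> // i; apply/seteqP; split=> [_ [x Tx <-]|x Tx].
    by rewrite (ea i) //; exact: Aut_fs_map (bAut i) Tx.
  have Tx' := Aut_fs_map (Aut_fs_inv (fsE i) (bAut i)) Tx.
  by exists ((b i)^-1%g x) => //; rewrite (ea i) // symKV.
exists a => //; apply/ffunP => i; apply: (Aut_fs_eq (F := E i)) => [||x Tx].
- exact: resA.
- exact: bAut.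
- by rewrite resE // (ea i).
Qed.

Hypothesis hF : fs_center F = [set 1] \/ focal F = fs_group F.
Hypothesis indE : forall i, indecomposable (E i).
Hypothesis factor_inj : forall i j, T i = T j -> i = j.

(** The inverse of g maps T_i onto some T_j, a fixes T_j, and g maps it back. *)
Lemma Aut0_normal : normal (Aut0_fs F E) (Aut_fs F).
Proof.
split; first by split; [exact: is_group_Aut0 | move=> a []].
move=> g a Ag [Aa a0]; have Ag' := Aut_fs_inv fsF Ag; split=> [|i].
  by apply: is_groupM => //; exact: is_groupM.
have [j ij] := Aut_factor_image fsF crd hF indE i Ag'.
by rewrite !sym_imageM ij a0 -(sym_imageV ij) invgK.
Qed.

Lemma Aut_factor_perm a : Aut_fs F a ->
  exists s : 'S_k, forall i, a @` T i = T (s i).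
Proof.
move=> Aa; have /choice[s sP] i := Aut_factor_image fsF crd hF indE i Aa.
have sI : injective s.
  move=> i j e; apply: factor_inj.
  by rewrite -(sym_imageV (sP i)) -(sym_imageV (sP j)) e.
by exists (perm sI) => i; rewrite permE.
Qed.

(** The permutation s is represented by the automorphism that carries the factor
    of index s i to the factor of index i.  This direction turns the product of
    permutations, which applies the left factor first, into the composite of
    automorphisms. *)
Lemma factor_permutations : exists kappa : 'S_k -> sym G,
  [/\ morphic (iso_perms E) (Aut_fs F) kappa,
      {in iso_perms E &, injective kappa} &
      forall s i, iso_perms E s -> kappa s @` T (s i) = T i].
Proof.
have [r [c [d [rP cdP]]]] := iso_class_charts fsE.
have rs s i : iso_perms E s -> r (s i) = r i by move=> es; exact: rP.
have cT i x : T (r i) x -> T i (c i x).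
  by have [[[[m _] _] _] _ _ _] := cdP i; exact: m.
have dT i x : T i x -> T (r i) (d i x).
  by have [_ [[[m _] _] _] _ _] := cdP i; exact: m.
have cK i x : T (r i) x -> d i (c i x) = x by have [_ _ + _] := cdP i; exact.
have dK i x : T i x -> c i (d i x) = x by have [_ _ _] := cdP i; exact.
have /choice[kappa kP] s : exists a, iso_perms E s -> Aut_fs F a /\
    forall i x, T (s i) x -> a x = c i (d (s i) x).
  have [es|n] := EM (iso_perms E s); last by exists 1%g.
  pose t := (s^-1)%g : 'S_k.
  have [|a [Aa ea]] := glue_Aut fsF crd (s := t) (g := fun i => c (t i) \o d i).
    move=> i; have [_ di _ _] := cdP i; have [ci _ _ _] := cdP (t i).
    have rt : r (t i) = r i by rewrite -(rs s (t i) es) permKV.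
    rewrite rt in ci; exact: fs_isomorphism_comp di ci.
  by exists a => _; split=> // i x Tx; rewrite (ea (s i)) //= /t permK.
have kA s : iso_perms E s -> Aut_fs F (kappa s) by move=> /kP[].
have kE s i x : iso_perms E s -> T (s i) x -> kappa s x = c i (d (s i) x).
  by move=> /kP[_]; exact.
have kT s i x : iso_perms E s -> T (s i) x -> T i (kappa s x).
  by move=> es Tx; rewrite (kE s i) //; apply: cT; rewrite -(rs s i es);
    exact: dT.
have kI s i : iso_perms E s -> kappa s @` T (s i) = T i.
  move=> es; apply/seteqP; split=> [_ [x Tx <-]|x Tx]; first exact: kT.
  have Tdx : T (r (s i)) (d i x) by rewrite rs //; exact: dT.
  exists (c (s i) (d i x)); first exact: cT.
  by rewrite (kE s i) //; [rewrite cK // dK | exact: cT].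
have gP := is_group_iso_perms fsE.
exists kappa; split=> //.
- split=> [s|s t /set_mem es /set_mem et]; first exact: kA.
  have est := is_groupM gP es et.
  apply: (Aut_fs_eq_factors fsF crd) => [||i x Tx]; first exact: kA.
    by apply: is_groupM gAut _ _; exact: kA.
  pose j := ((s * t)^-1)%g i; have ij : i = t (s j) by rewrite -permM /j permKV.
  rewrite ij in Tx; rewrite sym_mulE (kE t (s j)) // (kE s j) //; last first.
    by apply: cT; rewrite -(rs t) //; exact: dT.
  rewrite cK; last by rewrite -(rs t) //; exact: dT.
  by rewrite (kE _ j) // ?permM.
- move=> s t /set_mem es /set_mem et e; apply/permP => i; apply: factor_inj.
  by rewrite -(sym_imageV (kI s i es)) -(sym_imageV (kI t i et)) e.
Qed.

End AutomorphismGroup.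

Theorem corollary5p4 (G : groupType) (p : nat) (F : fusion_data G)
    (k : nat) (E : 'I_k -> fusion_data G) :
  prime p ->
  discrete_toral p (fs_group F) ->
  fusion_system F ->
  saturated p F ->
  fs_center F = [set 1] \/ focal F = fs_group F ->
  direct_decomposition F E ->
  (forall i, indecomposable (E i) /\ normal (fs_group (E i)) (fs_group F)) ->
  (* the definition of [indecomposable] admits trivial factors; two of them
     could be permuted without affecting the automorphisms of F *)
  (forall i j, fs_group (E i) = [set 1] -> fs_group (E j) = [set 1] -> i = j) ->
  [/\ isog (Aut0_fs F E) (direct_prod (fun i => Aut_fs (E i))),
      normal (Aut0_fs F E) (Aut_fs F) &
      exists K : set (sym G),
        [/\ subgroup K (Aut_fs F),
            isog K (iso_perms E),
            isog (iso_perms E) (cosets (Aut_fs F) (Aut0_fs F E)) &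
            semidirect (Aut_fs F) (Aut0_fs F E) K]].
Proof.
move=> _ _ fsF _ hF decE indN triv.
have indE i : indecomposable (E i) by case: (indN i).
have [I [J crd]] := direct_decomposition_coordinates decE.
have fsE := factor_fs crd; have gAut := is_group_Aut_fs fsF.
have gP := is_group_iso_perms fsE.
(* Distinct factors meet trivially, so that two factors with the same group are
   both trivial. *)
have factor_inj i j : fs_group (E i) = fs_group (E j) -> i = j.
  move=> ij; have [//|nij] := eqVneq i j.
  have T1 : fs_group (E i) = [set 1].
    apply/seteqP; split=> [x Tx|_ ->];
      last exact: is_group1 (factor_group crd i).
    by apply: (factors_disjoint crd Tx _ nij); rewrite -ij.
  by apply: triv; rewrite // -ij.
have nA0 := Aut0_normal fsF crd hF indE.
split; [exact: Aut0_isog fsF crd | exact: nA0 |].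
have [kappa [km kI kT]] := factor_permutations fsF crd factor_inj.
have kA s : iso_perms E s -> Aut_fs F (kappa s) by exact: km.1.
have PK : isog (iso_perms E) (kappa @` iso_perms E).
  exists kappa; split; first by split; [move=> s es; exists s | exact: km.2].
  by split=> // s es; exists s.
have gK : is_group (kappa @` iso_perms E) := is_group_image gP km.
have KA : kappa @` iso_perms E `<=` Aut_fs F by move=> _ [s es <-]; exact: kA.
have sd : semidirect (Aut_fs F) (Aut0_fs F E) (kappa @` iso_perms E).
  split=> //; apply/seteqP; split.
  - move=> a [[_ a0] [s es sa]]; rewrite -{a}sa in a0 *;
      suff -> : s = 1 by exact: morphic1 gP km.
    apply/permP => i; rewrite perm1; apply: factor_inj.
    by rewrite -[LHS](sym_imageV (kT s i es)) -[RHS](sym_imageV (a0 i)).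
  - move=> _ ->; split; last exact: is_group1 gK.
    exact: is_group1 (is_group_Aut0 E fsF).
  - by move=> _ [a [Aa _] [b /KA Ab <-]]; exact: is_groupM.
  move=> a Aa.
  have [t tP] := Aut_factor_perm fsF crd hF indE factor_inj Aa.
  pose s := t^-1.
  have es : iso_perms E s.
    move=> i; exists a; apply: (Aut_restrict fsF crd Aa).
    by rewrite tP permKV.
  have Ak := kA s es.
  exists (a * (kappa s)^-1); last first.
    by exists (kappa s); [exists s | rewrite mulgVK].
  split=> [|i]; first exact: gAut.2.
  by rewrite sym_imageM (sym_imageV (kT s i es)) tP permKV.
exists (kappa @` iso_perms E); split=> //.
  by apply: (isog_sym 1) PK => s t; exact: is_groupM gP.
exact: isog_trans PK (semidirect_quotient gAut sd).
Qed.
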